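(* Let $p\ge1$, $\varepsilon>0$, $\kappa>0$, $\gamma\in\mathbb R$, and let $F$ satisfy the conditions in the context with exponent $p$ and constant $K$. Let $\Phi(0)\in\ell^2$ with $\|\Phi(0)\|_{\ell^2}=A_0\varepsilon$, $A_0>0$, and let $\zeta\in X^1(\mathbb Z)$ satisfy $\lim_{n\to\pm\infty}\zeta_n=\zeta_\pm$, $|\zeta_\pm|=q_0$, and $$q_0=B\varepsilon,\quad\|\zeta\|_{\ell^\infty}=B_0\varepsilon,\quad\|\zeta'\|_{\ell^2}=B_1\varepsilon^{p+1},\quad\||\zeta|-q_0\|_{\ell^2}=B_2\varepsilon$$ for constants $B,B_0,B_1,B_2>0$. For $T>0$ let $$\rho(T)=2\Big[\|\Phi(0)\|_{\ell^2}+\sqrt{2\kappa}\|\zeta'\|_{\ell^2}\sqrt T+2^{2p+\frac32}|\gamma|K\big(\|\zeta\|_{\ell^\infty}+\||\zeta|-q_0\|_{\ell^2}+q_0\big)^{2p+1}T\Big],$$ and call $T$ a minimum guaranteed lifespan if $$2^{2p+\frac52}|\gamma|K\big(\rho(T)+\|\zeta\|_{\ell^\infty}+q_0\big)^{2p}T\le1.\qquad( * )$$ (i) Suppose $T=C/\varepsilon^{2p}$ with $C>0$ such that $( * )$ holds. Then there is a constant $A>0$, depending only on $C$, $A_0,B,B_0,B_1,B_2$ and $\kappa,\gamma,K,p$ (not otherwise on $\varepsilon$), such that the Cauchy problem for the modified gDNLS equation $$i\frac{d\Phi_n}{dt}+\kappa(\Delta(\Phi+\zeta))_n+\gamma\big[F(|\Phi_n+\zeta_n|^2)-F(q_0^2)\big](\Phi_n+\zeta_n)=0,\quad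 n\in\mathbb Z,$$ with initial datum $\Phi(0)$ and $\lim_{|n|\to\infty}\Phi_n(t)=0$ has its solution $\Phi\in C([0,T];\ell^2)$ satisfying $\sup_{t\in[0,T]}\|\Phi(t)\|_{\ell^2}\le A\varepsilon$. (ii) Conversely, if $T>0$ is such that $\rho(T)=A\varepsilon$ for some $A>0$ and $( * )$ holds, then $T=C/\varepsilon^{2p}$ for a constant $C>0$ depending only on $A$, $A_0,B,B_0,B_1,B_2$ and $\kappa,\gamma,K,p$ (not otherwise on $\varepsilon$).
   Context: $\ell^r=\ell^r(\mathbb Z)$ are spaces of complex sequences; $(\Delta u)_n:=u_{n+1}+u_{n-1}-2u_n$; $\zeta'_n:=\zeta_n-\zeta_{n-1}$; $X^1(\mathbb Z):=\{\zeta\in\ell^\infty:\zeta'\in\ell^2\}$; $|\zeta|-q_0$ denotes the sequence $(|\zeta_n|-q_0)_n$. Conditions on $F$: $F:\mathbb R\to\mathbb R$ is differentiable on $[0,\infty)$, $F(0)=0$, and for a constant $K>0$ and all $x,y\ge0$: $|F(x)-F(y)|\le K(|x|^{p-1}+|y|^{p-1})|x-y|$, $|F'(x)|\le K|x|^{p-1}$. A solution on $[0,T]$ is a function in $C([0,T];\ell^2)$ satisfying the equation integrated in time, as an identity in $\ell^2$. Whenever $T$ satisfies $( * )$, the Cauchy problem has a unique solution in the closed ball of radius $\rho(T)$ about $0$ in $C([0,T];\ell^2)$ (local well-posedness theorem of the paper); this is the solution referred to. *)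

(* Defs.v *)
From Stdlib Require Import Reals Lra Lia ZArith.
From Stdlib Require Import FunctionalExtensionality ProofIrrelevance.
From Coquelicot Require Import Coquelicot.
Open Scope R_scope.

(** * Bilateral series and the spaces of sequences on [Z] *)

Definition ex_seriesZ (a : Z -> R) : Prop :=
  ex_series (fun n : nat => a (Z.of_nat n)) /\
  ex_series (fun n : nat => a (- Z.of_nat (S n))%Z).

Definition SeriesZ (a : Z -> R) : R :=
  Series (fun n : nat => a (Z.of_nat n)) +
  Series (fun n : nat => a (- Z.of_nat (S n))%Z).

Definition in_ell2 (u : Z -> C) : Prop := ex_seriesZ (fun n => Cmod (u n) ^ 2).

(** Meaningful only under [in_ell2 u]. *)
Definition l2norm (u : Z -> C) : R := sqrt (SeriesZ (fun n => Cmod (u n) ^ 2)).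

Definition in_ellinf (u : Z -> C) : Prop :=
  exists M : R, forall n : Z, Cmod (u n) <= M.

(** Meaningful only under [in_ellinf u]. *)
Definition linfnorm (u : Z -> C) : R :=
  real (Lub_Rbar (fun x => exists n : Z, x = Cmod (u n))).

Lemma ex_seriesZ_le (a b : Z -> R) :
  (forall n, 0 <= a n <= b n) -> ex_seriesZ b -> ex_seriesZ a.
Proof.
  intros H [H1 H2]; split.
  - apply (ex_series_le (K := R_AbsRing) (V := R_CompleteNormedModule) _
             (fun n => b (Z.of_nat n))); [|assumption].
    intros n; change (norm (K := R_AbsRing)) with Rabs.
    simpl; rewrite Rabs_pos_eq; apply H.
  - apply (ex_series_le (K := R_AbsRing) (V := R_CompleteNormedModule) _
             (fun n => b (- Z.of_nat (S n))%Z)); [|assumption].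
    intros n; change (norm (K := R_AbsRing)) with Rabs.
    simpl; rewrite Rabs_pos_eq; apply H.
Qed.

Lemma ex_seriesZ_lin (a b : Z -> R) (c d : R) :
  ex_seriesZ a -> ex_seriesZ b -> ex_seriesZ (fun n => c * a n + d * b n).
Proof.
  intros [Ha1 Ha2] [Hb1 Hb2]; split; apply (ex_series_plus (V := R_NormedModule));
    apply (ex_series_scal (V := R_NormedModule)); assumption.
Qed.

Lemma SeriesZ_lin (a b : Z -> R) (c d : R) :
  ex_seriesZ a -> ex_seriesZ b ->
  SeriesZ (fun n => c * a n + d * b n) = c * SeriesZ a + d * SeriesZ b.
Proof.
  intros [Ha1 Ha2] [Hb1 Hb2]; unfold SeriesZ.
  rewrite !Series_plus;
    try (apply (ex_series_scal (V := R_NormedModule)); assumption).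
  rewrite !Series_scal_l; ring.
Qed.

Lemma SeriesZ_le (a b : Z -> R) :
  (forall n, 0 <= a n <= b n) -> ex_seriesZ b -> SeriesZ a <= SeriesZ b.
Proof.
  intros H [H1 H2]; apply Rplus_le_compat; apply Series_le; auto.
Qed.

Lemma SeriesZ_ext (a b : Z -> R) :
  (forall n, a n = b n) -> SeriesZ a = SeriesZ b.
Proof.
  intros H; unfold SeriesZ; f_equal; apply Series_ext; intros; apply H.
Qed.

Lemma ex_seriesZ_0 : ex_seriesZ (fun _ => 0).
Proof.
  assert (E : ex_series (fun _ : nat => 0)); [|split; exact E].
  exists 0; apply filterlim_ext with (fun _ : nat => 0);
    [|apply filterlim_const].
  intros n; symmetry; rewrite sum_n_Reals; apply sum_eq_R0; reflexivity.
Qed.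

Lemma SeriesZ_0 : SeriesZ (fun _ => 0) = 0.
Proof.
  rewrite (SeriesZ_ext _ (fun n => 0 * 0 + 0 * 0)) by (intros; ring).
  rewrite (SeriesZ_lin (fun _ => 0) (fun _ => 0)) by apply ex_seriesZ_0.
  ring.
Qed.

Lemma SeriesZ_pos (a : Z -> R) :
  (forall n, 0 <= a n) -> ex_seriesZ a -> 0 <= SeriesZ a.
Proof.
  intros H Ha; rewrite <- SeriesZ_0; apply SeriesZ_le; auto.
  intros; split; [lra | apply H].
Qed.

Lemma Series_term_le (a : nat -> R) (k : nat) :
  (forall n, 0 <= a n) -> ex_series a -> a k <= Series a.
Proof.
  intros H Ha.
  apply Rle_trans with (sum_n a k).
  - destruct k as [|k]; [rewrite sum_O; lra|].
    rewrite sum_Sn; unfold plus; simpl.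
    assert (0 <= sum_n a k); [|lra].
    rewrite sum_n_Reals; apply cond_pos_sum; assumption.
  - apply (is_lim_seq_incr_compare (sum_n a)).
    + apply Series_correct; assumption.
    + intros n; rewrite sum_Sn; unfold plus; simpl; specialize (H (S n)); lra.
Qed.

Lemma SeriesZ_term_le (a : Z -> R) (k : Z) :
  (forall n, 0 <= a n) -> ex_seriesZ a -> a k <= SeriesZ a.
Proof.
  intros H [H1 H2]; unfold SeriesZ.
  assert (P1 : 0 <= Series (fun n => a (Z.of_nat n))).
  { eapply Rle_trans; [apply (H (Z.of_nat 0))|].
    apply (Series_term_le (fun n => a (Z.of_nat n))); auto. }
  assert (P2 : 0 <= Series (fun n => a (- Z.of_nat (S n))%Z)).
  { eapply Rle_trans; [apply (H (- Z.of_nat 1)%Z)|].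
    apply (Series_term_le (fun n => a (- Z.of_nat (S n))%Z) 0); auto. }
  destruct (Z_le_gt_dec 0 k) as [Hk|Hk].
  - replace k with (Z.of_nat (Z.to_nat k)) at 1 by (apply Z2Nat.id; assumption).
    pose proof (Series_term_le (fun n => a (Z.of_nat n)) (Z.to_nat k)
                  (fun _ => H _) H1); simpl in *; lra.
  - replace k with (- Z.of_nat (S (Z.to_nat (- k - 1))))%Z at 1 by lia.
    pose proof (Series_term_le (fun n => a (- Z.of_nat (S n))%Z)
                  (Z.to_nat (- k - 1)) (fun _ => H _) H2); cbv beta in *; lra.
Qed.

Lemma pow2_le_inv (x y : R) : 0 <= y -> x ^ 2 <= y ^ 2 -> x <= y.
Proof. intros Hy H; destruct (Rle_lt_dec x y); [assumption | nra]. Qed.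

(** * [ell^2(Z)] as a real normed module *)

Record ell2 : Type := Ell2 {
  ell2_seq :> Z -> C;
  ell2_prop : in_ell2 ell2_seq
}.

Lemma ell2_eq (u v : ell2) : (forall n, u n = v n) -> u = v.
Proof.
  destruct u as [u Hu], v as [v Hv]; simpl; intros H.
  assert (u = v) by (apply functional_extensionality; assumption); subst v.
  f_equal; apply proof_irrelevance.
Qed.

Lemma Cmod_plus_sqr (a b : C) (s : R) : 0 < s ->
  Cmod (a + b) ^ 2 <= (1 + s) * Cmod a ^ 2 + (1 + / s) * Cmod b ^ 2.
Proof.
  intros Hs.
  pose proof (Cmod_triangle a b) as Ht.
  pose proof (Cmod_ge_0 (a + b)) as H0.
  apply Rle_trans with ((Cmod a + Cmod b) ^ 2).
  { apply pow_incr; split; assumption. }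
  assert (E : (1 + s) * Cmod a ^ 2 + (1 + / s) * Cmod b ^ 2
    - (Cmod a + Cmod b) ^ 2 = / s * (s * Cmod a - Cmod b) ^ 2)
    by (field; lra).
  assert (0 <= / s * (s * Cmod a - Cmod b) ^ 2); [|lra].
  apply Rmult_le_pos; [left; apply Rinv_0_lt_compat, Hs | apply pow2_ge_0].
Qed.

Lemma in_ell2_plus (u v : Z -> C) :
  in_ell2 u -> in_ell2 v -> in_ell2 (fun n => u n + v n)%C.
Proof.
  intros Hu Hv.
  apply ex_seriesZ_le with
    (fun n => (1 + 1) * Cmod (u n) ^ 2 + (1 + / 1) * Cmod (v n) ^ 2).
  - intros n; split; [apply pow2_ge_0 | apply Cmod_plus_sqr; lra].
  - apply (ex_seriesZ_lin (fun n => Cmod (u n) ^ 2) (fun n => Cmod (v n) ^ 2));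
      assumption.
Qed.

Lemma in_ell2_scal (c : C) (u : Z -> C) :
  in_ell2 u -> in_ell2 (fun n => c * u n)%C.
Proof.
  intros Hu.
  apply ex_seriesZ_le with
    (fun n => Cmod c ^ 2 * Cmod (u n) ^ 2 + 0 * Cmod (u n) ^ 2).
  - intros n; split; [apply pow2_ge_0 | rewrite Cmod_mult; right; ring].
  - apply (ex_seriesZ_lin (fun n => Cmod (u n) ^ 2) (fun n => Cmod (u n) ^ 2));
      assumption.
Qed.

Lemma in_ell2_opp (u : Z -> C) : in_ell2 u -> in_ell2 (fun n => - u n)%C.
Proof.
  intros Hu; apply ex_seriesZ_le with (fun n => Cmod (u n) ^ 2); [|assumption].
  intros n; split; [apply pow2_ge_0 | rewrite Cmod_opp; right; reflexivity].
Qed.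

Lemma in_ell2_zero : in_ell2 (fun _ => 0%C).
Proof.
  apply ex_seriesZ_le with (fun _ => 0); [|apply ex_seriesZ_0].
  intros n; rewrite Cmod_0; lra.
Qed.

Lemma l2norm_pos (u : Z -> C) : 0 <= l2norm u.
Proof. apply sqrt_pos. Qed.

Lemma l2norm_sqr (u : Z -> C) :
  in_ell2 u -> l2norm u ^ 2 = SeriesZ (fun n => Cmod (u n) ^ 2).
Proof.
  intros Hu; apply pow2_sqrt, SeriesZ_pos; [intros; apply pow2_ge_0 | exact Hu].
Qed.

Lemma l2norm_term (u : Z -> C) (n : Z) : in_ell2 u -> Cmod (u n) <= l2norm u.
Proof.
  intros Hu; apply pow2_le_inv; [apply l2norm_pos |].
  rewrite l2norm_sqr by assumption.
  apply (SeriesZ_term_le (fun n => Cmod (u n) ^ 2));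
    [intros; apply pow2_ge_0 | exact Hu].
Qed.

Lemma l2norm_eq0 (u : Z -> C) : in_ell2 u -> l2norm u = 0 -> forall n, u n = 0%C.
Proof.
  intros Hu H n; apply Cmod_eq_0, Rle_antisym; [|apply Cmod_ge_0].
  rewrite <- H; apply l2norm_term; assumption.
Qed.

Lemma l2norm_ext (u v : Z -> C) : (forall n, Cmod (u n) = Cmod (v n)) ->
  l2norm u = l2norm v.
Proof.
  intros H; unfold l2norm; f_equal; apply SeriesZ_ext; intros; now rewrite H.
Qed.

Lemma l2norm_triangle (u v : Z -> C) : in_ell2 u -> in_ell2 v ->
  l2norm (fun n => u n + v n)%C <= l2norm u + l2norm v.
Proof.
  intros Hu Hv.
  destruct (Rle_lt_or_eq_dec _ _ (l2norm_pos u)) as [Pu|Pu].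
  2:{ rewrite <- Pu; right; rewrite Rplus_0_l; apply l2norm_ext; intros n.
      rewrite (l2norm_eq0 u) by auto; now rewrite Cplus_0_l. }
  destruct (Rle_lt_or_eq_dec _ _ (l2norm_pos v)) as [Pv|Pv].
  2:{ rewrite <- Pv; right; rewrite Rplus_0_r; apply l2norm_ext; intros n.
      rewrite (l2norm_eq0 v) by auto; now rewrite Cplus_0_r. }
  set (s := l2norm v / l2norm u).
  assert (Hs : 0 < s) by (apply Rdiv_lt_0_compat; assumption).
  apply pow2_le_inv; [lra |].
  rewrite l2norm_sqr by (apply in_ell2_plus; assumption).
  apply Rle_trans with
    ((1 + s) * SeriesZ (fun n => Cmod (u n) ^ 2)
     + (1 + / s) * SeriesZ (fun n => Cmod (v n) ^ 2)).
  - rewrite <- (SeriesZ_lin (fun n => Cmod (u n) ^ 2) (fun n => Cmod (v n) ^ 2))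
      by assumption.
    apply SeriesZ_le.
    + intros n; split; [apply pow2_ge_0 | apply Cmod_plus_sqr; assumption].
    + apply (ex_seriesZ_lin (fun n => Cmod (u n) ^ 2)
               (fun n => Cmod (v n) ^ 2)); assumption.
  - rewrite <- !l2norm_sqr by assumption; unfold s; right; field; lra.
Qed.

Lemma l2norm_scal (c : C) (u : Z -> C) : in_ell2 u ->
  l2norm (fun n => c * u n)%C = Cmod c * l2norm u.
Proof.
  intros Hu; unfold l2norm.
  rewrite (SeriesZ_ext _
    (fun n => Cmod c ^ 2 * Cmod (u n) ^ 2 + 0 * Cmod (u n) ^ 2))
    by (intros; rewrite Cmod_mult; ring).
  rewrite (SeriesZ_lin (fun n => Cmod (u n) ^ 2) (fun n => Cmod (u n) ^ 2))
    by assumption.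
  rewrite Rmult_0_l, Rplus_0_r, sqrt_mult_alt by apply pow2_ge_0.
  rewrite sqrt_pow2 by apply Cmod_ge_0; reflexivity.
Qed.

Definition ell2_plus (u v : ell2) : ell2 :=
  Ell2 (fun n => u n + v n)%C (in_ell2_plus u v (ell2_prop u) (ell2_prop v)).
Definition ell2_opp (u : ell2) : ell2 :=
  Ell2 (fun n => - u n)%C (in_ell2_opp u (ell2_prop u)).
Definition ell2_zero : ell2 := Ell2 (fun _ => 0%C) in_ell2_zero.
Definition ell2_scal (c : R) (u : ell2) : ell2 :=
  Ell2 (fun n => RtoC c * u n)%C (in_ell2_scal (RtoC c) u (ell2_prop u)).

Definition ell2_AbelianMonoid_mixin : AbelianMonoid.mixin_of ell2.
Proof.
  apply (AbelianMonoid.Mixin ell2 ell2_plus ell2_zero);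
    intros; apply ell2_eq; intros; simpl; ring.
Defined.

Canonical ell2_AbelianMonoid : AbelianMonoid :=
  AbelianMonoid.Pack ell2 ell2_AbelianMonoid_mixin ell2.

Definition ell2_AbelianGroup_mixin : AbelianGroup.mixin_of ell2_AbelianMonoid.
Proof.
  apply (AbelianGroup.Mixin ell2_AbelianMonoid ell2_opp);
    intros; apply ell2_eq; intros; simpl; ring.
Defined.

Canonical ell2_AbelianGroup : AbelianGroup :=
  AbelianGroup.Pack ell2
    (AbelianGroup.Class ell2 ell2_AbelianMonoid_mixin ell2_AbelianGroup_mixin)
    ell2.

Definition ell2_ModuleSpace_mixin :
  ModuleSpace.mixin_of R_AbsRing ell2_AbelianGroup.
Proof.
  apply (ModuleSpace.Mixin R_AbsRing ell2_AbelianGroup ell2_scal);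
    intros; apply ell2_eq; intros; simpl;
    unfold mult, plus, one; simpl;
    rewrite ?RtoC_mult, ?RtoC_plus; ring.
Defined.

Canonical ell2_ModuleSpace : ModuleSpace R_AbsRing :=
  ModuleSpace.Pack R_AbsRing ell2
    (ModuleSpace.Class R_AbsRing ell2 _ ell2_ModuleSpace_mixin) ell2.

Definition ell2_ball (u : ell2) (e : R) (v : ell2) : Prop :=
  l2norm (minus v u) < e.

Definition ell2_UniformSpace_mixin : UniformSpace.mixin_of ell2.
Proof.
  apply (UniformSpace.Mixin ell2 ell2_zero ell2_ball); unfold ell2_ball.
  - intros u e; rewrite minus_eq_zero.
    apply Rle_lt_trans with 0; [|apply cond_pos].
    unfold l2norm; rewrite (SeriesZ_ext _ (fun _ => 0))
      by (intros; simpl; rewrite Cmod_0; ring).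
    rewrite SeriesZ_0, sqrt_0; lra.
  - intros u v e H.
    rewrite (l2norm_ext _ (minus v u)); [assumption|].
    intros n; simpl; rewrite <- Cmod_opp; f_equal; ring.
  - intros u v w e1 e2 H1 H2.
    apply Rle_lt_trans with (l2norm (minus v u) + l2norm (minus w v)); [|lra].
    eapply Rle_trans; [|apply l2norm_triangle; apply ell2_prop].
    right; apply l2norm_ext; intros n; simpl; f_equal; ring.
Defined.

Canonical ell2_UniformSpace : UniformSpace :=
  UniformSpace.Pack ell2 ell2_UniformSpace_mixin ell2.

Canonical ell2_NormedModuleAux : NormedModuleAux R_AbsRing :=
  NormedModuleAux.Pack R_AbsRing ell2
    (NormedModuleAux.Class R_AbsRing ell2 (ModuleSpace.class _ ell2_ModuleSpace)
       ell2_UniformSpace_mixin) ell2.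

Definition ell2_NormedModule_mixin :
  NormedModule.mixin_of R_AbsRing ell2_NormedModuleAux.
Proof.
  apply (NormedModule.Mixin R_AbsRing ell2_NormedModuleAux
           (fun u : ell2 => l2norm u) 1).
  - intros u v; apply l2norm_triangle; apply ell2_prop.
  - intros c u; simpl; rewrite l2norm_scal by apply ell2_prop.
    rewrite Cmod_R; right; reflexivity.
  - intros u v e H; exact H.
  - intros u v e H; rewrite Rmult_1_l; exact H.
  - intros u H; apply ell2_eq; intros n; apply l2norm_eq0;
      [apply ell2_prop | exact H].
Defined.

Canonical ell2_NormedModule : NormedModule R_AbsRing :=
  NormedModule.Pack R_AbsRing ell2
    (NormedModule.Class R_AbsRing ell2 _ ell2_NormedModule_mixin) ell2.

(** * The lattice equation *)

(** [Rpower 0 y] is [1] in the standard library; here [0 ^ 0 = 1] and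
    [0 ^ y = 0] for [y <> 0].  Used for [0 <= x] and [0 <= y] only. *)
Definition rpow (x y : R) : R :=
  if Req_EM_T x 0 then (if Req_EM_T y 0 then 1 else 0) else Rpower x y.

Definition lap (u : Z -> C) (n : Z) : C :=
  (u (n + 1)%Z + u (n - 1)%Z - 2 * u n)%C.

Definition bdiff (u : Z -> C) (n : Z) : C := (u n - u (n - 1)%Z)%C.

Definition in_X1 (z : Z -> C) : Prop := in_ellinf z /\ in_ell2 (bdiff z).

Definition mod_defect (z : Z -> C) (q0 : R) (n : Z) : C :=
  RtoC (Cmod (z n) - q0).

Definition limZ_pinf (u : Z -> C) (l : C) : Prop :=
  filterlim (fun n : nat => u (Z.of_nat n)) eventually (locally l).

Definition limZ_minf (u : Z -> C) (l : C) : Prop :=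
  filterlim (fun n : nat => u (- Z.of_nat n)%Z) eventually (locally l).

(** [D_in F F' (Rle 0) x] is differentiability relative to [[0, oo)], hence
    one-sided at [0]. *)
Definition F_cond (p K : R) (F : R -> R) : Prop :=
  F 0 = 0 /\
  (forall x y : R, 0 <= x -> 0 <= y ->
     Rabs (F x - F y)
       <= K * (rpow (Rabs x) (p - 1) + rpow (Rabs y) (p - 1)) * Rabs (x - y)) /\
  (exists F' : R -> R, forall x : R, 0 <= x ->
     D_in F F' (Rle 0) x /\ Rabs (F' x) <= K * rpow (Rabs x) (p - 1)).

(** [kappa (Delta (u + z))_n + gamma [F(|u_n + z_n|^2) - F(q0^2)] (u_n + z_n)] *)
Definition gdnls_op (kappa gamma q0 : R) (F : R -> R) (z u : Z -> C) (n : Z) : C :=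
  (RtoC kappa * lap (fun m => u m + z m) n
   + RtoC (gamma * (F (Cmod (u n + z n)%C ^ 2) - F (q0 ^ 2)))%R * (u n + z n))%C.

(** [Phi] is a curve in [ell2] whose values outside [[0, T]] are irrelevant.
    The witness [G] is the right-hand side along [Phi] as an [ell2]-valued
    curve; its integral [J] is the Riemann integral in the normed module
    [ell2].  The equation is [i (Phi(t) - Phi(0)) + J = 0]. *)
Definition is_solution (kappa gamma q0 : R) (F : R -> R) (z : Z -> C)
    (Phi0 : ell2) (T : R) (Phi : R -> ell2) : Prop :=
  continuous_on (fun t => 0 <= t <= T) Phi /\
  Phi 0 = Phi0 /\
  (forall t, 0 <= t <= T -> limZ_pinf (Phi t) 0 /\ limZ_minf (Phi t) 0) /\
  exists G : R -> ell2,
    (forall s, 0 <= s <= T ->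
       forall n : Z, G s n = gdnls_op kappa gamma q0 F z (Phi s) n) /\
    (forall t, 0 <= t <= T ->
       exists J : ell2, is_RInt G 0 t J /\
         forall n : Z, (Ci * (Phi t n - Phi0 n) + J n)%C = 0%C).

(** Norm of [C([0,T]; ell2)]. *)
Definition CT_norm (T : R) (Phi : R -> ell2) : Rbar :=
  Lub_Rbar (fun x => exists t : R, 0 <= t <= T /\ x = norm (Phi t)).

Definition rho (p kappa gamma K q0 : R) (Phi0 : ell2) (z : Z -> C) (T : R) : R :=
  2 * (norm Phi0
       + sqrt (2 * kappa) * l2norm (bdiff z) * sqrt T
       + Rpower 2 (2 * p + 3 / 2) * Rabs gamma * K
         * rpow (linfnorm z + l2norm (mod_defect z q0) + q0) (2 * p + 1) * T).

Definition min_lifespan (p kappa gamma K q0 : R) (Phi0 : ell2) (z : Z -> C)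
    (T : R) : Prop :=
  Rpower 2 (2 * p + 5 / 2) * Rabs gamma * K
  * rpow (rho p kappa gamma K q0 Phi0 z T + linfnorm z + q0) (2 * p) * T <= 1.

(** The assumptions relating the data to [eps].  The membership
    [in_ell2 (mod_defect z q0)] is implicit in the finiteness of its norm. *)
Definition data_cond (p eps A0 B B0 B1 B2 q0 : R) (Phi0 : ell2)
    (z : Z -> C) (zm zp : C) : Prop :=
  norm Phi0 = A0 * eps /\
  in_X1 z /\
  limZ_minf z zm /\ limZ_pinf z zp /\ Cmod zm = q0 /\ Cmod zp = q0 /\
  q0 = B * eps /\
  linfnorm z = B0 * eps /\
  l2norm (bdiff z) = B1 * Rpower eps (p + 1) /\
  in_ell2 (mod_defect z q0) /\ l2norm (mod_defect z q0) = B2 * eps.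

(* Main.v *)
Require Import Defs.
From Stdlib Require Import Reals ZArith Lra Lia.
From Stdlib Require Import ClassicalEpsilon FunctionalExtensionality PropExtensionality.
From Coquelicot Require Import Coquelicot.
Open Scope R_scope.

(** Truncate the nonlinearity by the radial retraction of [ell2] onto the ball
    of radius [rho(T)].  The right-hand side is then globally Lipschitz, and
    Picard iteration in the weighted norm [sup exp(-2Lt) |u(t)|] solves the
    truncated equation on all of [[0, T]].  The truncation is never active:
    writing [Phi = w + r], where [w] solves the linear equation
    [i w' + kappa Delta (w + zeta) = 0], [w(0) = 0], two energy identities give
    [|w(t)|^2 <= 2 kappa t |zeta'|^2] (conservation of the norm of the backward
    difference of [w + zeta]) and [|r(t)| <= |Phi(0)| + t sup |N|] (skewness of
    [i Delta]), and [( * )] makes the sum at most [rho(T)].  Under the scaling of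
    the data, [rho(T) / eps] is a strictly increasing function of
    [eps^(2p) T] alone, which gives both directions. *)

(** * Completeness of [ell2] *)

(** The obstacle is the forcing [kappa Delta zeta]. Estimated directly, it contributes a term of
    order [kappa T |zeta'|], which for [T] of order [eps^(-2p)] has size [eps^(1-p)] and destroys
    the bound [A eps]. Conservation of the norm of the backward difference replaces the factor [T]
    by [sqrt T], and [eps^(p+1) sqrt T] is again of order [eps]; this is the origin of the middle
    term of [rho(T)]. The truncated nonlinearity is evaluated only inside the ball, so it is bounded
    by [n0 + L rho(T)] whatever the solution does. The estimate therefore holds on all of [[0, T]]
    at once, with no continuation argument. The factor 2 in [rho(T)] leaves room for it: the data,
    the forcing and the nonlinearity at zero take one half of [rho(T)], and [L T <= 1/2] gives the
    Lipschitz part the other half. Since [q0 > 0], [zeta] is not square summable. The nonlinearity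
    still maps into [ell2], because at [zeta] it carries the factor [|zeta| - q0]. Completeness of
    [ell2] serves twice: for limits of iterates, and for the existence of integrals of continuous
    curves. *)

Lemma series_le_of_partial (a : nat -> R) (c : R) :
  (forall n, 0 <= a n) -> (forall N, sum_n a N <= c) ->
  ex_series a /\ Series a <= c.
Proof.
  intros Ha Hc.
  assert (E : ex_series a).
  { destruct (ex_finite_lim_seq_incr (sum_n a) c) as [l Hl].
    - intros n; rewrite sum_Sn; unfold plus; simpl; specialize (Ha (S n)); lra.
    - exact Hc.
    - exists l; exact Hl. }
  split; [exact E|].
  apply (is_lim_seq_le (sum_n a) (fun _ => c) (Series a) c Hc).
  - apply Series_correct; exact E.
  - apply is_lim_seq_const.
Qed.

Lemma sum_n_le_Series (a : nat -> R) (N : nat) :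
  (forall n, 0 <= a n) -> ex_series a -> sum_n a N <= Series a.
Proof.
  intros H Ha.
  apply (is_lim_seq_incr_compare (sum_n a)).
  - apply Series_correct; assumption.
  - intros n; rewrite sum_Sn; unfold plus; simpl; specialize (H (S n)); lra.
Qed.

Lemma is_lim_seq_sum_n (a : nat -> nat -> R) (b : nat -> R) (N : nat) :
  (forall n, is_lim_seq (fun l => a l n) (b n)) ->
  is_lim_seq (fun l => sum_n (a l) N) (sum_n b N).
Proof.
  intros H; induction N as [|N IH].
  - rewrite sum_O; apply is_lim_seq_ext with (fun l => a l O); [|apply H].
    intros l; now rewrite sum_O.
  - rewrite sum_Sn.
    apply is_lim_seq_ext with (fun l => sum_n (a l) N + a l (S N)).
    + intros l; now rewrite sum_Sn.
    + apply is_lim_seq_plus'; auto.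
Qed.

(** Fatou's lemma for coordinatewise limits: finite partial sums pass to the limit, and the two
    halves are bounded jointly so that the constant [c] is not lost. *)
Lemma l2norm_fatou (v : nat -> ell2) (u : Z -> C) (c : R) (l0 : nat) :
  (forall n, filterlim (fun l => v l n) eventually (locally (u n))) ->
  (forall l, (l0 <= l)%nat -> norm (v l) <= c) ->
  in_ell2 u /\ l2norm u <= c.
Proof.
  intros Hlim Hc.
  assert (c0 : 0 <= c).
  { apply Rle_trans with (norm (v l0)); [apply norm_ge_0 | apply Hc; lia]. }
  assert (Hsq : forall n,
    is_lim_seq (fun l => Cmod (v l n) ^ 2) (Cmod (u n) ^ 2)).
  { intros n; apply is_lim_seq_ext with (fun l => Cmod (v l n) * Cmod (v l n)).
    { intros; ring. }
    replace (Cmod (u n) ^ 2) with (Cmod (u n) * Cmod (u n)) by ring.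
    assert (is_lim_seq (fun l => Cmod (v l n)) (Cmod (u n))).
    { apply (filterlim_comp _ _ _ _ Cmod _ _ _ (Hlim n)).
      exact (@filterlim_norm C_AbsRing C_NormedModule (u n)). }
    apply is_lim_seq_mult'; assumption. }
  set (P := fun w : Z -> C => fun n : nat => Cmod (w (Z.of_nat n)) ^ 2).
  set (M := fun w : Z -> C => fun n : nat => Cmod (w (- Z.of_nat (S n))%Z) ^ 2).
  assert (HP : forall w n, 0 <= P w n) by (intros; apply pow2_ge_0).
  assert (HM : forall w n, 0 <= M w n) by (intros; apply pow2_ge_0).
  assert (Hsum : forall N1 N2, sum_n (P u) N1 + sum_n (M u) N2 <= c ^ 2).
  { intros N1 N2.
    assert (L : is_lim_seq (fun l => sum_n (P (v l)) N1 + sum_n (M (v l)) N2)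
                  (sum_n (P u) N1 + sum_n (M u) N2)).
    { apply is_lim_seq_plus'; apply is_lim_seq_sum_n; intros; apply Hsq. }
    apply (is_lim_seq_le_loc _ (fun _ => c ^ 2) _ (c ^ 2)) with (2 := L).
    2: apply is_lim_seq_const.
    exists l0; intros l Hl.
    destruct (ell2_prop (v l)) as [E1 E2].
    apply Rle_trans with (norm (v l) ^ 2).
    - change (norm (v l)) with (l2norm (v l)).
      rewrite l2norm_sqr by apply ell2_prop.
      apply Rplus_le_compat;
        [apply (sum_n_le_Series (P (v l))) | apply (sum_n_le_Series (M (v l)))];
        auto.
    - apply pow_incr; split; [apply norm_ge_0 | auto]. }
  assert (Hsplit : ex_series (P u) /\ Series (P u) <= c ^ 2).
  { apply series_le_of_partial; [apply HP|]; intros N.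
    specialize (Hsum N O); rewrite (sum_O (M u)) in Hsum.
    specialize (HM u O); lra. }
  destruct Hsplit as [EP _].
  (* With the negative partial sum fixed, the supremum over the positive ones is taken first; what
     it leaves of [c ^ 2] bounds every negative partial sum. *)
  assert (Hsplit : ex_series (M u) /\ Series (M u) <= c ^ 2 - Series (P u)).
  { apply series_le_of_partial; [apply HM|]; intros N.
    destruct (series_le_of_partial (P u) (c ^ 2 - sum_n (M u) N)) as [_ H].
    - apply HP.
    - intros N'; specialize (Hsum N' N); lra.
    - lra. }
  destruct Hsplit as [EM LM].
  assert (Hin : in_ell2 u) by (split; assumption).
  split; [exact Hin|].
  apply pow2_le_inv; [exact c0|].
  rewrite l2norm_sqr by exact Hin.
  unfold SeriesZ; fold (P u) (M u); change (Series (P u) + Series (M u) <= c ^ 2); lra.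
Qed.

(** A sequence of centres of balls of radius [/ (k + 1)] belonging to the filter stands in for the
    filter itself. Its coordinates converge in [C], and [l2norm_fatou] upgrades this to convergence
    in norm. *)
Lemma ell2_Cauchy_filter_lim (F : (ell2 -> Prop) -> Prop) :
  ProperFilter F -> cauchy F -> exists u : ell2, forall eps : posreal, F (ball u eps).
Proof.
  intros HF Hc.
  assert (Hd : forall k : nat, 0 < / (INR k + 1)) by (intros; apply RinvN_pos).
  destruct (choice (fun (k : nat) (x : ell2) => F (ball x (/ (INR k + 1)))))
    as [x Hx].
  { intros k; apply (Hc (mkposreal _ (Hd k))). }
  assert (Hxx : forall k l, norm (minus (x k) (x l)) < / (INR k + 1) + / (INR l + 1)).
  { intros k l.
    destruct (filter_ex _ (filter_and _ _ (Hx k) (Hx l))) as [y [H1 H2]].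
    apply ball_sym in H1.
    pose proof (ball_triangle _ _ _ _ _ H2 H1) as H3.
    rewrite Rplus_comm; exact H3. }
  assert (Hlim : forall n, exists c : C,
    filterlim (fun k => x k n) eventually (locally c)).
  { intros n.
    apply (filterlim_locally_cauchy (U := C_CompleteNormedModule)
             (fun k => x k n)).
    intros eps.
    assert (H2 : 0 < eps / 2) by (destruct eps; simpl; lra).
    assert (Hev : eventually (fun k => / (INR k + 1) < eps / 2)).
    { destruct (archimed_cor1 _ H2) as [N [HN1 HN2]].
      exists N; intros k Hk.
      apply Rle_lt_trans with (/ INR N); [|exact HN1].
      apply Rinv_le_contravar; [apply lt_0_INR; lia|].
      apply le_INR in Hk; lra. }
    exists (fun k => / (INR k + 1) < eps / 2); split; [exact Hev|].
    intros k l Hk Hl.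
    apply (@norm_compat1 C_AbsRing C_NormedModule).
    change (Cmod (minus (x l) (x k) n) < eps).
    apply Rle_lt_trans with (norm (minus (x l) (x k))).
    - apply (l2norm_term (minus (x l) (x k))); apply ell2_prop.
    - specialize (Hxx l k); lra. }
  apply choice in Hlim; destruct Hlim as [u0 Hu0].
  assert (Hk : forall k, in_ell2 (fun n => u0 n - x k n)%C /\
      l2norm (fun n => u0 n - x k n)%C <= 2 * / (INR k + 1)).
  { intros k.
    apply (l2norm_fatou (fun l => minus (x l) (x k)) _ _ k).
    - intros n.
      apply (filterlim_comp_2 (G := locally (u0 n)) (H := locally (opp (x k n)))
        (F := eventually) (fun l => x l n) (fun _ => opp (x k n)) plus);
        [apply Hu0 | apply filterlim_const |].
      exact (@filterlim_plus C_AbsRing C_NormedModule (u0 n) (opp (x k n))).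
    - intros l Hl; left; eapply Rlt_le_trans; [apply Hxx|].
      assert (/ (INR l + 1) <= / (INR k + 1)); [|lra].
      apply Rinv_le_contravar; [pose proof (pos_INR k); lra|].
      apply le_INR in Hl; lra. }
  assert (Hu : in_ell2 u0).
  { destruct (Hk O) as [H _].
    pose proof (in_ell2_plus _ _ H (ell2_prop (x O))) as H'.
    replace u0 with (fun n => u0 n - x O n + x O n)%C; [exact H'|].
    apply functional_extensionality; intros; ring. }
  exists (Ell2 u0 Hu); intros eps.
  assert (H4 : 0 < eps / 4) by (destruct eps; simpl; lra).
  destruct (archimed_cor1 _ H4) as [N [HN1 HN2]].
  assert (HN : / (INR N + 1) < eps / 4).
  { apply Rle_lt_trans with (/ INR N); [|exact HN1].
    apply Rinv_le_contravar; [apply lt_0_INR; lia| lra]. }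
  apply filter_imp with (2 := Hx N); intros y Hy.
  (* Balls are open while the limit only gives [<= 2 / (N + 1)], hence the 3; the ball around [x N]
     adds one more unit, which makes the 4 in [eps / 4]. *)
  assert (B1 : ball (Ell2 u0 Hu) (3 * / (INR N + 1)) (x N)).
  { apply ball_sym; change (l2norm (fun n => u0 n - x N n)%C < 3 * / (INR N + 1)).
    destruct (Hk N) as [_ H]; specialize (Hd N); lra. }
  apply ball_le with (3 * / (INR N + 1) + / (INR N + 1)); [lra|].
  eapply ball_triangle; eassumption.
Qed.

(** The complete space structure asks for a limit operator defined on arbitrary filters, so the
    limit point is picked by [epsilon]. *)
Definition ell2_lim (F : (ell2 -> Prop) -> Prop) : ell2 :=
  epsilon (inhabits ell2_zero) (fun u => forall eps : posreal, F (ball u eps)).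

Definition ell2_CompleteSpace_mixin : CompleteSpace.mixin_of ell2_UniformSpace.
Proof.
  apply (CompleteSpace.Mixin ell2_UniformSpace ell2_lim).
  - intros F HF Hc; unfold ell2_lim; apply epsilon_spec.
    now apply ell2_Cauchy_filter_lim.
  - intros F1 F2 H1 H2.
    (* Filters with the same members are equal by extensionality, so [epsilon] returns the same
       point for both. *)
    replace F2 with F1; [intros eps; apply ball_center|].
    apply functional_extensionality; intros P.
    apply propositional_extensionality; split; auto.
Defined.

Canonical ell2_CompleteNormedModule : CompleteNormedModule R_AbsRing :=
  CompleteNormedModule.Pack R_AbsRing ell2
    (CompleteNormedModule.Class R_AbsRing ell2
       (NormedModule.class R_AbsRing ell2_NormedModule) ell2_CompleteSpace_mixin) ell2.

(** * Picard iteration *)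

Lemma is_RInt_exp_weight (L c t : R) : 0 < L ->
  is_RInt (fun s => L * (c * exp (2 * L * s))) 0 t
    (c / 2 * exp (2 * L * t) - c / 2).
Proof.
  intros HL.
  replace (c / 2 * exp (2 * L * t) - c / 2) with
    (minus (c / 2 * exp (2 * L * t)) (c / 2 * exp (2 * L * 0))).
  2:{ rewrite Rmult_0_r, exp_0; unfold minus, plus, opp; simpl; ring. }
  apply (is_RInt_derive (fun t => c / 2 * exp (2 * L * t))).
  - intros s _; auto_derive; [exact I | field].
  - intros s _; apply (ex_derive_continuous (V := R_NormedModule)).
    auto_derive; exact I.
Qed.

(* The weight [exp (2 L s)] makes the integral operator contract by [1/2]
   on an interval of any length. *)
Lemma weighted_RInt_bound {V : NormedModule R_AbsRing} (f : R -> V) (I : V)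
    (L c t : R) :
  0 < L -> 0 <= t -> is_RInt f 0 t I ->
  (forall s, 0 <= s <= t -> norm (f s) <= L * (c * exp (2 * L * s))) ->
  norm I <= c / 2 * exp (2 * L * t).
Proof.
  intros HL Ht HI Hf.
  assert (Hc : 0 <= c).
  { specialize (Hf 0 (conj (Rle_refl 0) Ht)).
    rewrite Rmult_0_r, exp_0, Rmult_1_r in Hf.
    pose proof (norm_ge_0 (f 0)); nra. }
  pose proof (norm_RInt_le f _ 0 t I _ Ht Hf HI (is_RInt_exp_weight L c t HL)).
  lra.
Qed.

(** Projection of the line onto [[0, T]]. Iterates that depend on time only through it are
    continuous at every real and inherit for all times the bounds proved on [[0, T]]. *)
Definition clamp (T t : R) : R := Rmax 0 (Rmin t T).

Lemma clamp_id (T t : R) : 0 <= t <= T -> clamp T t = t.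
Proof.
  intros [H1 H2]; unfold clamp; rewrite Rmin_left, Rmax_right; auto.
Qed.

Lemma clamp_range (T t : R) : 0 <= T -> 0 <= clamp T t <= T.
Proof.
  intros HT; unfold clamp; split; [apply Rmax_l|].
  apply Rmax_lub; [exact HT | apply Rmin_r].
Qed.

Lemma clamp_clamp (T t : R) : 0 <= T -> clamp T (clamp T t) = clamp T t.
Proof. intros HT; apply clamp_id, clamp_range, HT. Qed.

Lemma continuous_clamp (T t : R) : continuous (clamp T) t.
Proof.
  apply filterlim_locally; intros eps; exists eps; intros s Hs.
  change (Rabs (clamp T s - clamp T t) < eps).
  change (Rabs (s - t) < eps) in Hs.
  apply Rle_lt_trans with (2 := Hs).
  unfold clamp, Rmax, Rmin; unfold Rabs;
  repeat (destruct (Rle_dec _ _) || destruct (Rcase_abs _)); lra.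
Qed.

(** * Group identities, the norm distance and continuity *)

Lemma minus_plus_l {G : AbelianGroup} (x y : G) : minus (plus x y) x = y.
Proof.
  unfold minus; rewrite (plus_comm x), <- plus_assoc.
  etransitivity; [apply f_equal, (plus_opp_r x) | apply plus_zero_r].
Qed.

Lemma minus_minus_r {G : AbelianGroup} (x y z : G) :
  minus (minus x z) (minus y z) = minus x y.
Proof.
  rewrite (minus_trans z x y); unfold minus at 1; rewrite opp_minus; reflexivity.
Qed.

Lemma eq_of_minus_zero {G : AbelianGroup} (x y : G) : minus x y = zero -> x = y.
Proof.
  intros H; transitivity (plus (minus x y) y).
  - unfold minus; rewrite <- plus_assoc; symmetry.
    etransitivity; [apply f_equal, plus_opp_l | apply plus_zero_r].
  - etransitivity; [apply (f_equal (fun z => plus z y) H) | apply plus_zero_l].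
Qed.

Definition ndist {V : NormedModule R_AbsRing} (x y : V) : R := norm (minus x y).

Lemma ndist_self {V : NormedModule R_AbsRing} (x : V) : ndist x x = 0.
Proof. unfold ndist; rewrite minus_eq_zero; apply (norm_zero (V := V)). Qed.

Lemma ndist_sym {V : NormedModule R_AbsRing} (x y : V) :
  ndist x y = ndist y x.
Proof. unfold ndist; rewrite <- norm_opp, opp_minus; reflexivity. Qed.

Lemma ndist_triangle {V : NormedModule R_AbsRing} (x y z : V) :
  ndist x z <= ndist x y + ndist y z.
Proof. unfold ndist; rewrite (minus_trans y x z); apply norm_triangle. Qed.

Lemma ndist_ge_0 {V : NormedModule R_AbsRing} (x y : V) : 0 <= ndist x y.
Proof. apply norm_ge_0. Qed.

Lemma ndist_ball {V : NormedModule R_AbsRing} (x y : V) (e : R) :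
  ndist y x < e -> ball x e y.
Proof. apply norm_compat1. Qed.

Lemma filterlim_minus_const {V : NormedModule R_AbsRing} {T : Type}
    {F : (T -> Prop) -> Prop} {FF : Filter F} (x : T -> V) (l a : V) :
  filterlim x F (locally l) ->
  filterlim (fun t => minus (x t) a) F (locally (minus l a)).
Proof.
  intros H.
  apply (filterlim_comp_2 (G := locally l) (H := locally (opp a)) x (fun _ => opp a) plus);
    [exact H | apply filterlim_const | apply filterlim_plus].
Qed.

Lemma continuous_ndist {V : NormedModule R_AbsRing} {T : UniformSpace}
    (f : T -> V) (t : T) :
  continuous f t <->
  (forall eps : posreal, locally t (fun s => ndist (f s) (f t) < eps)).
Proof.
  split.
  - intros H eps.
    apply (proj1 (filterlim_locally_ball_norm f (f t)) H eps).
  - intros H; apply filterlim_locally_ball_norm; exact H.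
Qed.

Lemma continuous_lipschitz {V W : NormedModule R_AbsRing} (f : V -> W) (L : R) (x : V) :
  0 < L -> (forall y, ndist (f y) (f x) <= L * ndist y x) ->
  continuous f x.
Proof.
  intros HL Hf; apply continuous_ndist; intros eps.
  assert (He : 0 < eps / L) by (apply Rdiv_lt_0_compat; [apply cond_pos | exact HL]).
  apply filter_imp with (2 := locally_ball_norm x (mkposreal _ He)).
  intros y Hy; apply Rle_lt_trans with (1 := Hf y).
  unfold ball_norm in Hy; simpl in Hy.
  apply Rmult_lt_compat_l with (r := L) in Hy; [|exact HL].
  replace (L * (eps / L)) with (pos eps) in Hy by (field; lra); exact Hy.
Qed.

Lemma continuous_RInt_upper {V : CompleteNormedModule R_AbsRing} (g : R -> V) (a t : R) :
  (forall s, continuous g s) -> continuous (fun t => RInt g a t) t.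
Proof.
  intros Hg; apply (ex_derive_continuous (V := V)); exists (g t).
  apply (is_derive_RInt g _ a t); [|apply Hg].
  apply filter_forall; intros b; apply (RInt_correct g), ex_RInt_continuous; auto.
Qed.

(** Telescoping of a geometric series. The explicit rate matters: with [M] independent of time, it
    turns pointwise limits of curves into uniform ones. *)
Lemma geometric_Cauchy_lim {V : CompleteNormedModule R_AbsRing} (x : nat -> V) (M : R) :
  (forall n, ndist (x (S n)) (x n) <= M * (/ 2) ^ n) ->
  exists l : V, forall n, ndist (x n) l <= 2 * M * (/ 2) ^ n.
Proof.
  intros Hx.
  assert (Hmn : forall n k, ndist (x (k + n)%nat) (x n)
                  <= 2 * M * (/ 2) ^ n * (1 - (/ 2) ^ k)).
  { intros n; induction k as [|k IH].
    - right; rewrite Rminus_diag_eq by reflexivity; rewrite Rmult_0_r.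
      apply (ndist_self (V := V)).
    - eapply Rle_trans; [apply (ndist_triangle _ (x (k + n)%nat))|].
      specialize (Hx (k + n)%nat); rewrite pow_add in Hx.
      change (S k + n)%nat with (S (k + n)); simpl pow; lra. }
  assert (HM : 0 <= M).
  { specialize (Hx O); simpl in Hx; rewrite Rmult_1_r in Hx.
    eapply Rle_trans; [apply (ndist_ge_0 (V := V)) | exact Hx]. }
  assert (Hp : forall n, 0 < (/ 2) ^ n) by (intros; apply pow_lt; lra).
  assert (Hmn' : forall n m, (n <= m)%nat ->
     ndist (x m) (x n) <= 2 * M * (/ 2) ^ n).
  { intros n m H; replace m with ((m - n) + n)%nat by lia.
    eapply Rle_trans; [apply Hmn|].
    rewrite <- (Rmult_1_r (2 * M * (/ 2) ^ n)) at 2.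
    apply Rmult_le_compat_l; [specialize (Hp n); nra|].
    specialize (Hp (m - n)%nat); lra. }
  assert (Hz : is_lim_seq (fun n => 2 * M * (/ 2) ^ n) 0).
  { replace (Finite 0) with (Rbar_mult (2 * M) 0) by (simpl; f_equal; ring).
    apply is_lim_seq_scal_l, is_lim_seq_geom; rewrite Rabs_pos_eq; lra. }
  destruct (proj1 (filterlim_locally_cauchy (F := eventually) x)) as [l Hl].
  { intros eps.
    destruct (proj2 (is_lim_seq_spec _ 0) Hz (pos_div_2 eps)) as [N HN].
    specialize (HN N (le_n _)); rewrite Rminus_0_r in HN.
    apply Rle_lt_trans with (1 := Rle_abs _) in HN.
    exists (fun n => (N <= n)%nat); split; [exists N; auto|].
    intros u v Hu Hv; apply (ndist_ball (V := V)).
    eapply Rle_lt_trans; [apply (ndist_triangle _ (x N))|].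
    rewrite (ndist_sym (x N)).
    pose proof (Hmn' N u Hu); pose proof (Hmn' N v Hv); simpl in HN; lra. }
  exists l; intros n; rewrite ndist_sym.
  apply (is_lim_seq_le_loc (fun m => ndist (x m) (x n))
    (fun _ => 2 * M * (/ 2) ^ n) (ndist l (x n)) (2 * M * (/ 2) ^ n)).
  - exists n; intros m Hm; apply Hmn'; exact Hm.
  - apply (filterlim_comp _ _ _ _ _ _ _ _ (filterlim_minus_const (V := V) x l (x n) Hl)).
    apply (filterlim_norm (V := V)).
  - apply is_lim_seq_const.
Qed.

Section Picard.

Context {V : CompleteNormedModule R_AbsRing} (f : V -> V) (L : R) (x0 : V) (T : R).
Hypothesis HL : 0 < L.
Hypothesis HT : 0 <= T.
Hypothesis Hf : forall x y, ndist (f x) (f y) <= L * ndist x y.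

Fixpoint picard_iter (n : nat) : R -> V :=
  match n with
  | O => fun _ => x0
  | S n => fun t => plus x0 (RInt (fun s => f (picard_iter n s)) 0 (clamp T t))
  end.

Lemma picard_iter_continuous (n : nat) (t : R) : continuous (picard_iter n) t.
Proof.
  revert t; induction n as [|n IH]; intros t; simpl.
  - apply continuous_const.
  - apply (continuous_plus (V := V)); [apply continuous_const|].
    apply (continuous_comp (clamp T)
             (fun b => RInt (fun s => f (picard_iter n s)) 0 b)).
    + apply continuous_clamp.
    + apply continuous_RInt_upper; intros s.
      apply (continuous_comp (picard_iter n) f); [apply IH|].
      apply (continuous_lipschitz (V := V) (W := V) f L); auto.
Qed.

Lemma picard_iter_is_RInt (n : nat) (t : R) : 0 <= t <= T ->
  is_RInt (fun s => f (picard_iter n s)) 0 t (minus (picard_iter (S n) t) x0).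
Proof.
  intros Ht; simpl; rewrite clamp_id by exact Ht.
  match goal with |- is_RInt _ _ _ (minus (plus _ ?r) _) =>
    replace (minus (plus x0 r) x0) with r end.
  - apply (RInt_correct (V := V)), ex_RInt_continuous; intros s _.
    apply (continuous_comp (picard_iter n) f).
    + apply picard_iter_continuous.
    + apply (continuous_lipschitz (V := V) (W := V) f L); auto.
  - symmetry; apply (minus_plus_l (G := V)).
Qed.

Lemma picard_iter_clamp (n : nat) (t : R) :
  picard_iter n t = picard_iter n (clamp T t).
Proof. destruct n; simpl; [|rewrite clamp_clamp]; auto. Qed.

Lemma picard_iter_diff (n : nat) (t : R) : 0 <= t <= T ->
  ndist (picard_iter (S n) t) (picard_iter n t)
  <= norm (f x0) / L * (/ 2) ^ n * exp (2 * L * t).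
Proof.
  revert t; induction n as [|n IH]; intros t Ht.
  (* The first increment is the integral of the constant [f x0], with no contraction to exploit; the
     factor 2 offsets the halving in [weighted_RInt_bound]. *)
  - apply Rle_trans with (2 * (norm (f x0) / L) / 2 * exp (2 * L * t)).
    2: simpl; right; field; lra.
    apply weighted_RInt_bound with (3 := picard_iter_is_RInt 0 t Ht);
      [exact HL | apply Ht |].
    intros s Hs; simpl.
    assert (1 <= exp (2 * L * s)).
    { replace 1 with (exp 0) by apply exp_0.
      destruct (Rle_lt_or_eq_dec 0 (2 * L * s)) as [H|H]; [nra | |].
      - left; apply exp_increasing, H.
      - rewrite <- H; right; reflexivity. }
    replace (L * (2 * (norm (f x0) / L) * exp (2 * L * s)))
      with (2 * norm (f x0) * exp (2 * L * s)) by (field; lra).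
    pose proof (norm_ge_0 (f x0)); nra.
  - replace (norm (f x0) / L * (/ 2) ^ S n * exp (2 * L * t)) with
      (norm (f x0) / L * (/ 2) ^ n / 2 * exp (2 * L * t)) by (simpl; field; lra).
    apply (weighted_RInt_bound
      (fun s => minus (f (picard_iter (S n) s)) (f (picard_iter n s))));
      [exact HL | apply Ht | |].
    + refine (eq_ind _ (is_RInt _ 0 t) _ _ (minus_minus_r (G := V) _ _ x0)).
      apply (is_RInt_minus (V := V)); apply picard_iter_is_RInt; exact Ht.
    + intros s Hs; eapply Rle_trans; [apply Hf|].
      apply Rmult_le_compat_l; [lra|]; apply IH; lra.
Qed.

Lemma picard_ODE :
  exists phi : R -> V,
    (forall t, continuous phi t) /\
    (forall t, 0 <= t <= T ->
       is_RInt (fun s => f (phi s)) 0 t (minus (phi t) x0)).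
Proof.
  set (M := norm (f x0) / L * exp (2 * L * T)).
  assert (Hd : forall t n,
    ndist (picard_iter (S n) t) (picard_iter n t) <= M * (/ 2) ^ n).
  { intros t n; rewrite (picard_iter_clamp (S n)), (picard_iter_clamp n).
    pose proof (clamp_range T t HT) as Hc.
    eapply Rle_trans; [apply picard_iter_diff, Hc|].
    unfold M; rewrite Rmult_assoc, (Rmult_comm (_ ^ n)), <- Rmult_assoc.
    apply Rmult_le_compat_r; [apply pow_le; lra|].
    apply Rmult_le_compat_l.
    - apply Rmult_le_pos; [apply norm_ge_0 | left; apply Rinv_0_lt_compat, HL].
    - destruct (proj2 Hc) as [H|H]; [|rewrite H; right; reflexivity].
      left; apply exp_increasing; nra. }
  destruct (choice _ (fun t => geometric_Cauchy_lim _ M (Hd t))) as [phi Hphi].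
  assert (Hz : forall c, is_lim_seq (fun n => c * (2 * M * (/ 2) ^ n)) 0).
  { intros c; replace (Finite 0) with (Rbar_mult (c * (2 * M)) 0)
      by (simpl; f_equal; ring).
    apply is_lim_seq_ext with (fun n => c * (2 * M) * (/ 2) ^ n); [intros; ring|].
    apply is_lim_seq_scal_l, is_lim_seq_geom; rewrite Rabs_pos_eq; lra. }
  assert (Hu : forall c (eps : posreal), exists N, forall n, (N <= n)%nat ->
     c * (2 * M * (/ 2) ^ n) < eps).
  { intros c eps.
    destruct (proj2 (is_lim_seq_spec _ 0) (Hz c) eps) as [N HN].
    exists N; intros n Hn; specialize (HN n Hn); rewrite Rminus_0_r in HN.
    apply Rle_lt_trans with (1 := Rle_abs _) in HN; exact HN. }
  exists phi; split.
  - intros t; apply (continuous_ndist (V := V)); intros eps.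
    destruct (Hu 3 eps) as [N HN]; specialize (HN N (le_n _)).
    assert (He : 0 < eps / 3) by (destruct eps; simpl; lra).
    apply filter_imp with (2 := proj1 (continuous_ndist (V := V) _ t)
      (picard_iter_continuous N t) (mkposreal _ He)).
    simpl; intros s Hs.
    pose proof (Hphi s N); pose proof (Hphi t N).
    eapply Rle_lt_trans; [apply (ndist_triangle _ (picard_iter N s))|].
    rewrite ndist_sym.
    pose proof (ndist_triangle (picard_iter N s) (picard_iter N t) (phi t)).
    lra.
  - intros t Ht.
    (* The integrands must converge uniformly over the whole line; they do, since the rate in [Hphi]
       holds at every real time and [f] is Lipschitz. *)
    destruct (filterlim_RInt (fun n s => f (picard_iter n s)) 0 t eventually _
      (fun s => f (phi s)) (fun n => minus (picard_iter (S n) t) x0)) as [I [H1 H2]].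
    + intros n; apply picard_iter_is_RInt; exact Ht.
    + apply (filterlim_locally (U := fct_UniformSpace R V)).
      intros eps; destruct (Hu L eps) as [N HN]; exists N; intros n Hn s.
      apply (ndist_ball (V := V)); eapply Rle_lt_trans; [apply Hf|].
      eapply Rle_lt_trans; [|apply (HN n Hn)].
      apply Rmult_le_compat_l; [lra | apply Hphi].
    + replace (minus (phi t) x0) with I; [exact H2|].
      apply (filterlim_locally_unique _ _ _ H1).
      apply (filterlim_minus_const (V := V) (fun n => picard_iter (S n) t)).
      apply filterlim_locally; intros eps.
      destruct (Hu 1 eps) as [N HN]; exists N; intros n Hn.
      apply (ndist_ball (V := V)).
      eapply Rle_lt_trans; [apply Hphi|].
      specialize (HN (S n)); rewrite Rmult_1_l in HN; apply HN; lia.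
Qed.

End Picard.

(** Each pass through the integral equation halves the weighted bound, starting from the crude bound
    [M]. The Lipschitz estimate is asked only along the two curves, so a field that is Lipschitz
    merely on a ball is allowed, and the integrands may be any functions, such as the witness in
    [is_solution]. *)
Lemma ODE_unique {V : NormedModule R_AbsRing} (phi psi g h : R -> V) (x0 : V)
    (L M T : R) :
  0 < L ->
  (forall t, 0 <= t <= T -> is_RInt g 0 t (minus (phi t) x0)) ->
  (forall t, 0 <= t <= T -> is_RInt h 0 t (minus (psi t) x0)) ->
  (forall t, 0 <= t <= T -> ndist (phi t) (psi t) <= M) ->
  (forall t, 0 <= t <= T -> ndist (g t) (h t) <= L * ndist (phi t) (psi t)) ->
  forall t, 0 <= t <= T -> phi t = psi t.
Proof.
  intros HL Hphi Hpsi HM Hgh.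
  assert (Hn : forall n t, 0 <= t <= T ->
    ndist (phi t) (psi t) <= M * (/ 2) ^ n * exp (2 * L * t)).
  { induction n as [|n IH]; intros t Ht.
    - specialize (HM t Ht); simpl; rewrite Rmult_1_r.
      pose proof (exp_ineq1_le (2 * L * t)).
      pose proof (ndist_ge_0 (phi t) (psi t)).
      assert (0 <= 2 * L * t) by nra.
      nra.
    - replace (M * (/ 2) ^ S n * exp (2 * L * t)) with
        (M * (/ 2) ^ n / 2 * exp (2 * L * t)) by (simpl; field).
      apply (weighted_RInt_bound (fun s => minus (g s) (h s)));
        [exact HL | apply Ht | |].
      + refine (eq_ind _ (is_RInt _ 0 t) _ _ (minus_minus_r (G := V) _ _ x0)).
        apply (is_RInt_minus (V := V)); auto.
      + intros s Hs; eapply Rle_trans; [apply Hgh; lra|].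
        apply Rmult_le_compat_l; [lra | apply IH; lra]. }
  intros t Ht.
  assert (H0 : ndist (phi t) (psi t) <= 0).
  { apply (is_lim_seq_le (fun _ => ndist (phi t) (psi t))
      (fun n => M * exp (2 * L * t) * (/ 2) ^ n) (ndist (phi t) (psi t)) 0).
    - intros n; pose proof (Hn n t Ht); lra.
    - apply is_lim_seq_const.
    - replace (Finite 0) with (Rbar_mult (M * exp (2 * L * t)) 0)
        by (simpl; f_equal; ring).
      apply is_lim_seq_scal_l, is_lim_seq_geom; rewrite Rabs_pos_eq; lra. }
  assert (H : minus (phi t) (psi t) = zero).
  { apply norm_eq_zero, Rle_antisym; [exact H0 | apply norm_ge_0]. }
  apply eq_of_minus_zero; exact H.
Qed.

(** * Inner product and difference operators *)

Lemma ex_seriesZ_shift (a : Z -> R) : ex_seriesZ a -> ex_seriesZ (fun n => a (n + 1)%Z).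
Proof.
  intros [H1 H2]; split.
  - apply ex_series_ext with (fun n => a (Z.of_nat (S n))).
    + intros n; f_equal; lia.
    + apply (ex_series_incr_1 (fun n => a (Z.of_nat n))); exact H1.
  - apply (ex_series_incr_1 (V := R_NormedModule)
      (fun n => a (- Z.of_nat (S n) + 1)%Z)).
    apply ex_series_ext with (fun n => a (- Z.of_nat (S n))%Z); [|exact H2].
    intros n; f_equal; lia.
Qed.

Lemma ex_seriesZ_unshift (a : Z -> R) :
  ex_seriesZ a -> ex_seriesZ (fun n => a (n - 1)%Z).
Proof.
  intros [H1 H2]; split.
  - apply (ex_series_incr_1 (V := R_NormedModule) (fun n => a (Z.of_nat n - 1)%Z)).
    apply ex_series_ext with (fun n => a (Z.of_nat n)); [|exact H1].
    intros n; f_equal; lia.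
  - apply ex_series_ext with (fun n => a (- Z.of_nat (S (S n)))%Z).
    + intros n; f_equal; lia.
    + apply (ex_series_incr_1 (fun n => a (- Z.of_nat (S n))%Z)); exact H2.
Qed.

(** The shift moves the single term [a 0] from the nonnegative half of the bilateral series to the
    negative half. *)
Lemma SeriesZ_shift (a : Z -> R) :
  ex_seriesZ a -> SeriesZ (fun n => a (n + 1)%Z) = SeriesZ a.
Proof.
  intros Ha; pose proof (ex_seriesZ_shift a Ha) as [_ H2]; destruct Ha as [H1 _].
  unfold SeriesZ.
  rewrite (Series_incr_1 (fun n => a (Z.of_nat n)) H1).
  rewrite (Series_incr_1 _ H2).
  rewrite (Series_ext (fun n => a (Z.of_nat n + 1)%Z) (fun n => a (Z.of_nat (S n))))
    by (intros n; f_equal; lia).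
  rewrite (Series_ext (fun n => a (- Z.of_nat (S (S n)) + 1)%Z)
             (fun n => a (- Z.of_nat (S n))%Z)) by (intros n; f_equal; lia).
  simpl (- Z.of_nat 1 + 1)%Z; simpl (Z.of_nat 0); ring.
Qed.

(** * The real inner product of [ell2] *)

(** The real part of [a] times the conjugate of [b]. Energy identities need only the real inner
    product, and [ell2] is a module over the reals. *)
Definition cdot (a b : C) : R := fst a * fst b + snd a * snd b.

Lemma cdot_Cmod (a : C) : cdot a a = Cmod a ^ 2.
Proof. unfold cdot, Cmod; rewrite pow2_sqrt; nra. Qed.

Lemma cdot_polar (a b : C) :
  cdot a b = / 4 * Cmod (a + b) ^ 2 + - / 4 * Cmod (a + - b) ^ 2.
Proof. rewrite <- !cdot_Cmod; unfold cdot; simpl; field. Qed.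

(** By polarization, summability follows from membership of [u + v] and [u - v] in [ell2]. *)
Lemma ex_seriesZ_cdot (u v : ell2) : ex_seriesZ (fun n => cdot (u n) (v n)).
Proof.
  replace (fun n => cdot (u n) (v n)) with
    (fun n => / 4 * Cmod (u n + v n) ^ 2 + - / 4 * Cmod (u n + - v n) ^ 2).
  - apply (ex_seriesZ_lin (fun n => Cmod (u n + v n)%C ^ 2)
             (fun n => Cmod (u n + - v n)%C ^ 2)).
    + apply (ell2_prop (plus u v)).
    + apply (ell2_prop (plus u (opp v))).
  - apply functional_extensionality; intros n; symmetry; apply cdot_polar.
Qed.

Definition ell2_inner (u v : ell2) : R := SeriesZ (fun n => cdot (u n) (v n)).

Lemma ell2_inner_sym (u v : ell2) : ell2_inner u v = ell2_inner v u.
Proof. apply SeriesZ_ext; intros n; unfold cdot; ring. Qed.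

Lemma ell2_inner_plus_r (u v w : ell2) :
  ell2_inner u (plus v w) = ell2_inner u v + ell2_inner u w.
Proof.
  unfold ell2_inner.
  rewrite (SeriesZ_ext _ (fun n => 1 * cdot (u n) (v n) + 1 * cdot (u n) (w n))).
  - rewrite (SeriesZ_lin (fun n => cdot (u n) (v n)) (fun n => cdot (u n) (w n)))
      by apply ex_seriesZ_cdot; ring.
  - intros n; unfold cdot; simpl; ring.
Qed.

Lemma ell2_inner_scal_r (u v : ell2) (c : R) :
  ell2_inner u (scal c v) = c * ell2_inner u v.
Proof.
  unfold ell2_inner.
  rewrite (SeriesZ_ext _ (fun n => c * cdot (u n) (v n) + 0 * cdot (u n) (v n))).
  - rewrite (SeriesZ_lin (fun n => cdot (u n) (v n)) (fun n => cdot (u n) (v n)))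
      by apply ex_seriesZ_cdot; ring.
  - intros n; unfold cdot; simpl; ring.
Qed.

Lemma ell2_inner_opp_r (u v : ell2) : ell2_inner u (opp v) = - ell2_inner u v.
Proof.
  replace (opp v) with (scal (-1) v).
  - rewrite ell2_inner_scal_r; ring.
  - apply ell2_eq; intros n; simpl; ring.
Qed.

Lemma ell2_inner_minus_r (u v w : ell2) :
  ell2_inner u (minus v w) = ell2_inner u v - ell2_inner u w.
Proof.
  unfold minus; rewrite ell2_inner_plus_r, ell2_inner_opp_r; reflexivity.
Qed.

Lemma ell2_inner_self (u : ell2) : ell2_inner u u = norm u ^ 2.
Proof.
  change (norm u) with (l2norm u); rewrite l2norm_sqr by apply ell2_prop.
  apply SeriesZ_ext; intros n; apply cdot_Cmod.
Qed.

Lemma norm_plus_sqr (u v : ell2) :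
  norm (plus u v) ^ 2 = norm u ^ 2 + 2 * ell2_inner u v + norm v ^ 2.
Proof.
  rewrite <- !ell2_inner_self, ell2_inner_plus_r, (ell2_inner_sym _ u),
    (ell2_inner_sym _ v), !ell2_inner_plus_r, (ell2_inner_sym v u); ring.
Qed.

(** The Cauchy-Schwarz inequality, read off from the triangle inequality by expanding the square of
    the norm of a sum. *)
Lemma ell2_inner_le (u v : ell2) : ell2_inner u v <= norm u * norm v.
Proof.
  pose proof (norm_plus_sqr u v) as H.
  assert (Ht : norm (plus u v) ^ 2 <= (norm u + norm v) ^ 2).
  { apply pow_incr; split; [apply norm_ge_0 | apply (norm_triangle u v)]. }
  nra.
Qed.

Lemma Rabs_ell2_inner_le (u v : ell2) : Rabs (ell2_inner u v) <= norm u * norm v.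
Proof.
  apply Rabs_le; split; [|apply ell2_inner_le].
  pose proof (ell2_inner_le u (opp v)) as H.
  rewrite ell2_inner_opp_r in H.
  assert (E : norm (opp v) = norm v) by apply (norm_opp (V := ell2_NormedModule)).
  rewrite E in H; lra.
Qed.

Lemma is_derive_norm_sqr (u : R -> ell2) (t : R) (g : ell2) :
  is_derive u t g -> is_derive (fun s => norm (u s) ^ 2) t (2 * ell2_inner (u t) g).
Proof.
  intros Hu.
  assert (Hq : filterdiff (fun x : ell2 => norm x ^ 2) (locally (u t))
                 (fun h => 2 * ell2_inner (u t) h)).
  { split.
    - split.
      + intros x y; rewrite ell2_inner_plus_r; unfold plus; simpl; ring.
      + intros k x; rewrite ell2_inner_scal_r; unfold scal; simpl; unfold mult; simpl; ring.
      + exists (2 * norm (u t) + 1); split; [pose proof (norm_ge_0 (u t)); lra|].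
        intros x; change (Rabs (2 * ell2_inner (u t) x) <= (2 * norm (u t) + 1) * norm x).
        rewrite Rabs_mult, (Rabs_pos_eq 2) by lra.
        pose proof (Rabs_ell2_inner_le (u t) x); pose proof (norm_ge_0 x); nra.
    - intros x Hx eps.
      assert (Ex : u t = x) by (apply is_filter_lim_locally_unique; exact Hx).
      rewrite <- Ex; clear x Hx Ex.
      apply filter_imp with (2 := locally_ball_norm (u t) eps).
      intros y Hy.
      (* The remainder of the first-order expansion is exactly the squared distance, hence
         negligible against the distance. *)
      assert (E : minus (minus (norm y ^ 2) (norm (u t) ^ 2))
                    (2 * ell2_inner (u t) (minus y (u t))) = ndist y (u t) ^ 2).
      { change (norm y ^ 2 - norm (u t) ^ 2 - 2 * ell2_inner (u t) (minus y (u t))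
                = norm (minus y (u t)) ^ 2).
        replace y with (plus (u t) (minus y (u t))) at 1.
        - rewrite norm_plus_sqr; ring.
        - apply ell2_eq; intros n; simpl; ring. }
      change (Rabs (minus (minus (norm y ^ 2) (norm (u t) ^ 2))
                    (2 * ell2_inner (u t) (minus y (u t)))) <= eps * ndist y (u t)).
      rewrite E, Rabs_pos_eq by apply pow2_ge_0.
      pose proof (ndist_ge_0 y (u t)).
      change (ndist y (u t) < eps) in Hy; nra. }
  pose proof (filterdiff_comp' u (fun x : ell2 => norm x ^ 2) t _ _ Hu Hq) as H.
  apply (filterdiff_ext_lin _ _ _ H); intros y.
  rewrite ell2_inner_scal_r; unfold scal; simpl; unfold mult; simpl; ring.
Qed.

(** * Multiplication by [i], shifts and differences *)

Lemma Ci_Cmod : Cmod Ci = 1.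
Proof.
  unfold Cmod; simpl; replace (_ + _) with 1 by ring; apply sqrt_1.
Qed.

(** Only real scalars act on the module [ell2], so multiplication by [i] is a separate map. *)
Definition ell2_imul (u : ell2) : ell2 :=
  Ell2 (fun n => Ci * u n)%C (in_ell2_scal Ci u (ell2_prop u)).

Definition ell2_shift (u : ell2) : ell2 :=
  Ell2 (fun n => u (n + 1)%Z) (ex_seriesZ_shift _ (ell2_prop u)).

Definition ell2_unshift (u : ell2) : ell2 :=
  Ell2 (fun n => u (n - 1)%Z) (ex_seriesZ_unshift _ (ell2_prop u)).

Definition fdiff (u : ell2) : ell2 := minus (ell2_shift u) u.

Definition ell2_bdiff (u : ell2) : ell2 := minus u (ell2_unshift u).

Lemma norm_imul (u : ell2) : norm (ell2_imul u) = norm u.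
Proof.
  change (l2norm (fun n => Ci * u n)%C = l2norm u).
  rewrite l2norm_scal, Ci_Cmod by apply ell2_prop; ring.
Qed.

Lemma norm_shift (u : ell2) : norm (ell2_shift u) = norm u.
Proof.
  change (l2norm (ell2_shift u) = l2norm u); unfold l2norm; f_equal.
  apply (SeriesZ_shift (fun n => Cmod (u n) ^ 2)), ell2_prop.
Qed.

Lemma shift_unshift (u : ell2) : ell2_shift (ell2_unshift u) = u.
Proof. apply ell2_eq; intros n; simpl; f_equal; lia. Qed.

Lemma norm_unshift (u : ell2) : norm (ell2_unshift u) = norm u.
Proof. rewrite <- norm_shift, shift_unshift; reflexivity. Qed.

Lemma ell2_norm_minus_le (u v : ell2) : norm (minus u v) <= norm u + norm v.
Proof.
  eapply Rle_trans; [apply (norm_triangle u (opp v))|].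
  right; f_equal; apply (norm_opp (V := ell2_NormedModule)).
Qed.

Lemma norm_fdiff (u : ell2) : norm (fdiff u) <= 2 * norm u.
Proof.
  eapply Rle_trans; [apply ell2_norm_minus_le | rewrite norm_shift; lra].
Qed.

Lemma norm_bdiff (u : ell2) : norm (ell2_bdiff u) <= 2 * norm u.
Proof.
  eapply Rle_trans; [apply ell2_norm_minus_le | rewrite norm_unshift; lra].
Qed.

Lemma inner_shift (u v : ell2) :
  ell2_inner (ell2_shift u) (ell2_shift v) = ell2_inner u v.
Proof. apply (SeriesZ_shift (fun n => cdot (u n) (v n))), ex_seriesZ_cdot. Qed.

(** Summation by parts. There is no boundary term because the shift preserves the inner product and
    is inverse to [ell2_unshift]. *)
Lemma inner_fdiff (u v : ell2) :
  ell2_inner u (fdiff v) = - ell2_inner (ell2_bdiff u) v.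
Proof.
  unfold fdiff, ell2_bdiff.
  rewrite (ell2_inner_sym _ v), !ell2_inner_minus_r, (ell2_inner_sym v u).
  rewrite <- (inner_shift v), shift_unshift, (ell2_inner_sym (ell2_shift v)); ring.
Qed.

Lemma inner_imul_r (u v : ell2) : ell2_inner u (ell2_imul v) = - ell2_inner (ell2_imul u) v.
Proof.
  rewrite (ell2_inner_sym _ v), <- ell2_inner_opp_r.
  apply SeriesZ_ext; intros n; unfold cdot; simpl; ring.
Qed.

Lemma inner_imul_self (u : ell2) : ell2_inner u (ell2_imul u) = 0.
Proof.
  pose proof (inner_imul_r u u) as H; rewrite (ell2_inner_sym _ u) in H; lra.
Qed.

Lemma fdiff_imul (u : ell2) : fdiff (ell2_imul u) = ell2_imul (fdiff u).
Proof. apply ell2_eq; intros n; simpl; ring. Qed.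

Lemma bdiff_imul (u : ell2) : ell2_bdiff (ell2_imul u) = ell2_imul (ell2_bdiff u).
Proof. apply ell2_eq; intros n; simpl; ring. Qed.

Lemma bdiff_fdiff (u : ell2) : ell2_bdiff (fdiff u) = fdiff (ell2_bdiff u).
Proof.
  apply ell2_eq; intros n; simpl.
  replace (n - 1 + 1)%Z with n by lia; replace (n + 1 - 1)%Z with n by lia; ring.
Qed.

(* [i] times the discrete Laplacian is skew-adjoint, so it drops out of energy
   estimates. *)
Lemma inner_imul_lap (u : ell2) :
  ell2_inner u (ell2_imul (fdiff (ell2_bdiff u))) = 0.
Proof.
  rewrite <- fdiff_imul, inner_fdiff, inner_imul_self; ring.
Qed.

(** * Energy estimates *)

(** A linear map commutes with Riemann sums, and its continuity passes this to the limit. It carries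
    the integral equation across multiplication by [i]. *)
Lemma is_RInt_linear {U V : NormedModule R_AbsRing} (l : U -> V) (f : R -> U)
    (a b : R) (I : U) :
  is_linear l -> is_RInt f a b I -> is_RInt (fun s => l (f s)) a b (l I).
Proof.
  intros Hl HI.
  apply (filterlim_ext (fun ptd => l (scal (sign (b - a)) (Riemann_sum f ptd)))).
  - intros ptd; rewrite (linear_scal l Hl); f_equal.
    apply SF_cons_ind with (s := ptd); clear ptd.
    + intros x; unfold Riemann_sum; simpl; apply (linear_zero l Hl).
    + intros h s IH; rewrite !Riemann_sum_cons, (linear_plus l Hl), (linear_scal l Hl), IH.
      reflexivity.
  - eapply filterlim_comp; [exact HI | apply linear_cont, Hl].
Qed.

(** Differentiability is asked only on the open interval, since an integral equation on [[0, T]]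
    yields no two-sided derivative at the endpoints; continuity covers those. *)
Lemma growth_of_derive_le (f df : R -> R) (c T t : R) :
  (forall s, 0 < s < T -> is_derive f s (df s)) ->
  (forall s, continuous f s) ->
  (forall s, 0 <= s <= T -> df s <= c) ->
  0 <= t <= T -> f t <= f 0 + c * t.
Proof.
  intros Hd Hc Hb Ht.
  destruct (MVT_gen f 0 t df) as [s [Hs E]].
  - rewrite Rmin_left, Rmax_right by apply Ht.
    intros s Hs; apply Hd; lra.
  - intros s _; apply continuity_pt_filterlim, Hc.
  - rewrite Rmin_left, Rmax_right in Hs by apply Ht.
    specialize (Hb s ltac:(lra)); nra.
Qed.

Lemma continuous_norm_sqr (u : R -> ell2) (t : R) :
  continuous u t -> continuous (fun s => norm (u s) ^ 2) t.
Proof.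
  intros Hu; apply (continuous_comp u (fun x : ell2 => norm x ^ 2)); [exact Hu|].
  apply continuous_ext with (fun x : ell2 => norm x * norm x).
  { intros x; change (norm x * norm x = norm x ^ 2); ring. }
  apply (continuous_mult (K := R_AbsRing));
    apply (filterlim_norm (V := ell2_NormedModule)).
Qed.

Lemma norm_sqr_growth (u g : R -> ell2) (c T t : R) :
  (forall s, 0 < s < T -> is_derive u s (g s)) ->
  (forall s, continuous u s) ->
  (forall s, 0 <= s <= T -> 2 * ell2_inner (u s) (g s) <= c) ->
  0 <= t <= T -> norm (u t) ^ 2 <= norm (u 0) ^ 2 + c * t.
Proof.
  intros Hd Hc Hb.
  apply (growth_of_derive_le (fun s => norm (u s) ^ 2)
    (fun s => 2 * ell2_inner (u s) (g s))).
  - intros s Hs; apply is_derive_norm_sqr, Hd, Hs.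
  - intros s; apply continuous_norm_sqr, Hc.
  - exact Hb.
Qed.

(* The norm need not be differentiable where [u] vanishes, hence the
   regularization [sqrt (norm u ^ 2 + e ^ 2)]. *)
Lemma norm_growth (u g : R -> ell2) (c T t : R) :
  0 <= c ->
  (forall s, 0 < s < T -> is_derive u s (g s)) ->
  (forall s, continuous u s) ->
  (forall s, 0 <= s <= T -> ell2_inner (u s) (g s) <= c * norm (u s)) ->
  0 <= t <= T -> norm (u t) <= norm (u 0) + c * t.
Proof.
  intros Hc0 Hd Hc Hb Ht; apply Rle_plus_epsilon; intros e He.
  assert (Hpos : forall s, 0 < norm (u s) ^ 2 + e ^ 2).
  { intros s; pose proof (pow2_ge_0 (norm (u s))); pose proof (pow_lt e 2 He); lra. }
  assert (H : sqrt (norm (u t) ^ 2 + e ^ 2) <= sqrt (norm (u 0) ^ 2 + e ^ 2) + c * t).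
  { apply (growth_of_derive_le (fun s => sqrt (norm (u s) ^ 2 + e ^ 2))
      (fun s => 2 * ell2_inner (u s) (g s) / (2 * sqrt (norm (u s) ^ 2 + e ^ 2))) c T).
    - intros s Hs.
      apply (is_derive_ext (fun s => sqrt ((fun r => norm (u r) ^ 2 + e ^ 2) s)));
        [reflexivity|].
      apply (is_derive_sqrt (fun r => norm (u r) ^ 2 + e ^ 2)); [|apply Hpos].
      replace (2 * ell2_inner (u s) (g s)) with (2 * ell2_inner (u s) (g s) + 0) by ring.
      apply (is_derive_plus (K := R_AbsRing) (V := R_NormedModule)).
      + apply is_derive_norm_sqr, Hd, Hs.
      + apply (is_derive_const (K := R_AbsRing) (V := R_NormedModule)).
    - intros s; apply continuous_sqrt_comp.
      apply (continuous_plus (V := R_NormedModule)).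
      + apply continuous_norm_sqr, Hc.
      + apply continuous_const.
    - intros s Hs; specialize (Hb s Hs).
      pose proof (sqrt_lt_R0 _ (Hpos s)) as Hq.
      assert (Hn : norm (u s) <= sqrt (norm (u s) ^ 2 + e ^ 2)).
      { rewrite <- (sqrt_pow2 (norm (u s))) at 1 by apply norm_ge_0.
        apply sqrt_le_1_alt; pose proof (pow2_ge_0 e); lra. }
      apply Rmult_le_reg_r with (2 * sqrt (norm (u s) ^ 2 + e ^ 2)); [lra|].
      unfold Rdiv; rewrite Rmult_assoc, Rinv_l, Rmult_1_r by lra; nra.
    - exact Ht. }
  assert (H1 : norm (u t) <= sqrt (norm (u t) ^ 2 + e ^ 2)).
  { rewrite <- (sqrt_pow2 (norm (u t))) at 1 by apply norm_ge_0.
    apply sqrt_le_1_alt; pose proof (pow2_ge_0 e); lra. }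
  assert (H2 : sqrt (norm (u 0) ^ 2 + e ^ 2) <= norm (u 0) + e).
  { pose proof (norm_ge_0 (u 0)).
    rewrite <- (sqrt_pow2 (norm (u 0) + e)) by lra.
    apply sqrt_le_1_alt; nra. }
  lra.
Qed.

Lemma ODE_derive (f : ell2 -> ell2) (phi : R -> ell2) (x0 : ell2) (T t : R) :
  (forall x, continuous f x) -> (forall s, continuous phi s) ->
  (forall s, 0 <= s <= T ->
     is_RInt (fun r => f (phi r)) 0 s (minus (phi s) x0)) ->
  0 < t < T -> is_derive phi t (f (phi t)).
Proof.
  intros Hf Hphi HI Ht.
  apply (is_derive_ext (fun s => plus (minus (phi s) x0) x0)).
  { intros s; apply ell2_eq; intros n; simpl; ring. }
  replace (f (phi t)) with (plus (f (phi t)) zero)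
    by (apply ell2_eq; intros n; simpl; ring).
  apply (is_derive_plus (V := ell2_NormedModule));
    [|apply (is_derive_const (V := ell2_NormedModule))].
  apply (is_derive_RInt (fun r => f (phi r)) (fun s => minus (phi s) x0) 0 t).
  - assert (He : 0 < Rmin t (T - t)) by (apply Rmin_glb_lt; lra).
    exists (mkposreal _ He); intros s Hs; apply HI.
    change (Rabs (s - t) < Rmin t (T - t)) in Hs.
    pose proof (Rmin_l t (T - t)); pose proof (Rmin_r t (T - t)).
    apply Rabs_def2 in Hs; lra.
  - apply (continuous_comp phi f); auto.
Qed.

Lemma is_linear_imul : is_linear (U := ell2_NormedModule) (V := ell2_NormedModule) ell2_imul.
Proof.
  split.
  - intros u v; apply ell2_eq; intros n; simpl; ring.
  - intros k u; apply ell2_eq; intros n; simpl; ring.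
  - exists 1; split; [lra|]; intros u.
    change (norm (ell2_imul u) <= 1 * norm u); rewrite norm_imul; lra.
Qed.

Lemma is_linear_bdiff : is_linear (U := ell2_NormedModule) (V := ell2_NormedModule) ell2_bdiff.
Proof.
  split.
  - intros u v; apply ell2_eq; intros n; simpl; ring.
  - intros k u; apply ell2_eq; intros n; simpl; ring.
  - exists 2; split; [lra|]; apply norm_bdiff.
Qed.

(* [w' = lap_field kappa d w] is [i w' + kappa Delta (w + zeta) = 0] when [d] is the
   backward difference of [zeta], as [Delta] is [fdiff] after [ell2_bdiff]. *)
Definition lap_field (kappa : R) (d u : ell2) : ell2 :=
  scal kappa (ell2_imul (fdiff (plus (ell2_bdiff u) d))).

Lemma lap_field_minus (kappa : R) (d u v : ell2) :
  minus (lap_field kappa d u) (lap_field kappa d v)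
  = scal kappa (ell2_imul (fdiff (ell2_bdiff (minus u v)))).
Proof. apply ell2_eq; intros n; simpl; ring. Qed.

Lemma ell2_norm_scal (c : R) (u : ell2) : norm (scal c u) = Rabs c * norm u.
Proof.
  change (l2norm (fun n => RtoC c * u n)%C = Rabs c * l2norm u).
  rewrite l2norm_scal, Cmod_R by apply ell2_prop; reflexivity.
Qed.

Lemma lap_field_lipschitz (kappa : R) (d u v : ell2) : 0 < kappa ->
  ndist (lap_field kappa d u) (lap_field kappa d v) <= 4 * kappa * ndist u v.
Proof.
  intros Hk.
  change (norm (minus (lap_field kappa d u) (lap_field kappa d v))
          <= 4 * kappa * norm (minus u v)).
  rewrite lap_field_minus, ell2_norm_scal, Rabs_pos_eq, norm_imul by lra.
  pose proof (norm_fdiff (ell2_bdiff (minus u v))).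
  pose proof (norm_bdiff (minus u v)); nra.
Qed.

(* With [y = ell2_bdiff w + d], the norm of [y] is conserved, and the derivative of
   [norm w ^ 2] equals [2 kappa <d, i y>]. *)
Lemma lap_flow_bound (kappa T t : R) (d : ell2) (w : R -> ell2) :
  0 < kappa -> (forall s, continuous w s) -> w 0 = zero ->
  (forall s, 0 < s < T -> is_derive w s (lap_field kappa d (w s))) ->
  0 <= t <= T ->
  norm (w t) <= sqrt (2 * kappa) * norm d * sqrt t.
Proof.
  intros Hk Hc Hw0 Hd Ht.
  set (y := fun s : R => plus (ell2_bdiff (w s)) d).
  assert (Hyd : forall s, 0 < s < T ->
    is_derive y s (ell2_bdiff (lap_field kappa d (w s)))).
  { intros s Hs.
    replace (ell2_bdiff (lap_field kappa d (w s))) with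
      (plus (ell2_bdiff (lap_field kappa d (w s))) zero)
      by (apply ell2_eq; intros n; simpl; ring).
    apply (is_derive_plus (V := ell2_NormedModule));
      [|apply (is_derive_const (V := ell2_NormedModule))].
    pose proof (filterdiff_comp' w ell2_bdiff s _ _ (Hd s Hs)
      (filterdiff_linear ell2_bdiff is_linear_bdiff)) as H.
    apply (filterdiff_ext_lin _ _ _ H); intros r.
    apply (linear_scal ell2_bdiff is_linear_bdiff). }
  assert (Hyc : forall s, continuous y s).
  { intros s; apply (continuous_plus (V := ell2_NormedModule));
      [|apply continuous_const].
    apply (continuous_comp w ell2_bdiff); [apply Hc|].
    apply (linear_cont (U := ell2_NormedModule) (V := ell2_NormedModule)).
    apply is_linear_bdiff. }
  (* The source [d] enters only through [y], so the backward difference turns the forced equation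
     for [w] into a homogeneous one for [y]. *)
  assert (Hbl : forall s, ell2_bdiff (lap_field kappa d (w s))
     = scal kappa (ell2_imul (fdiff (ell2_bdiff (y s))))).
  { intros s; unfold lap_field; fold (y s).
    rewrite <- bdiff_fdiff, <- bdiff_imul.
    exact (linear_scal ell2_bdiff is_linear_bdiff kappa (ell2_imul (fdiff (y s)))). }
  assert (Hy : forall s, 0 <= s <= T -> norm (y s) <= norm d).
  { intros s Hs; apply pow2_le_inv; [apply norm_ge_0|].
    replace (norm d ^ 2) with (norm (y 0) ^ 2 + 0 * s).
    - apply (norm_sqr_growth y (fun s => ell2_bdiff (lap_field kappa d (w s))) 0 T);
        auto.
      intros r _; rewrite Hbl, ell2_inner_scal_r, inner_imul_lap; lra.
    - rewrite Rmult_0_l, Rplus_0_r; f_equal; f_equal; unfold y; rewrite Hw0.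
      apply ell2_eq; intros n; simpl; ring. }
  assert (Hw : norm (w t) ^ 2 <= norm (w 0) ^ 2 + 2 * kappa * norm d ^ 2 * t).
  { apply (norm_sqr_growth w (fun s => lap_field kappa d (w s)) _ T); auto.
    intros s Hs; unfold lap_field; fold (y s).
    assert (E : ell2_bdiff (w s) = minus (y s) d).
    { apply ell2_eq; intros n; unfold y; simpl; ring. }
    (* Summation by parts gives [- <y - d, i y>], and the part in [y] vanishes by skewness. *)
    rewrite ell2_inner_scal_r, <- fdiff_imul, inner_fdiff, E.
    rewrite (ell2_inner_sym (minus (y s) d)), ell2_inner_minus_r.
    rewrite (ell2_inner_sym _ (y s)), inner_imul_self.
    pose proof (ell2_inner_le (ell2_imul (y s)) d) as H; rewrite norm_imul in H.
    pose proof (Hy s Hs); pose proof (norm_ge_0 d).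
    assert (ell2_inner (ell2_imul (y s)) d <= norm d ^ 2) by nra.
    nra. }
  apply pow2_le_inv.
  { repeat apply Rmult_le_pos; apply sqrt_pos || apply norm_ge_0. }
  rewrite !Rpow_mult_distr, !pow2_sqrt by lra.
  rewrite Hw0 in Hw.
  assert (E : norm (zero : ell2) = 0) by apply (norm_zero (V := ell2_NormedModule)).
  rewrite E in Hw; lra.
Qed.

(** * Radial retraction and the truncated flow *)

Definition ball_retract (r : R) (u : ell2) : ell2 := scal (r / Rmax r (norm u)) u.

Lemma norm_ball_retract (r : R) (u : ell2) : 0 < r -> norm (ball_retract r u) <= r.
Proof.
  intros Hr; unfold ball_retract; rewrite ell2_norm_scal.
  pose proof (Rmax_l r (norm u)) as H1; pose proof (Rmax_r r (norm u)) as H2.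
  rewrite Rabs_pos_eq by (apply Rlt_le, Rdiv_lt_0_compat; lra).
  apply Rmult_le_reg_r with (Rmax r (norm u)); [lra|].
  replace (r / Rmax r (norm u) * norm u * Rmax r (norm u)) with (r * norm u)
    by (field; lra).
  nra.
Qed.

Lemma ball_retract_id (r : R) (u : ell2) : 0 < r -> norm u <= r -> ball_retract r u = u.
Proof.
  intros Hr Hu; unfold ball_retract; rewrite Rmax_left by exact Hu.
  replace (r / r) with 1 by (field; lra).
  apply ell2_eq; intros n; simpl; ring.
Qed.

(** One unit comes from [u - v], the other from the change of the scaling factor, which multiplies
    [v] with [norm v <= b]. The constant 2 is harmless: it enters the Lipschitz constant of the
    truncated field, not the bound on the solution. *)
Lemma ball_retract_lipschitz (r : R) (u v : ell2) : 0 < r ->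
  ndist (ball_retract r u) (ball_retract r v) <= 2 * ndist u v.
Proof.
  intros Hr; unfold ball_retract.
  set (a := Rmax r (norm u)); set (b := Rmax r (norm v)).
  pose proof (Rmax_l r (norm u)) as Ha; fold a in Ha.
  pose proof (Rmax_l r (norm v)) as Hb; fold b in Hb.
  pose proof (Rmax_r r (norm v)) as Hbv; fold b in Hbv.
  assert (Hab : Rabs (b - a) <= norm (minus u v)).
  { apply Rle_trans with (Rabs (norm u - norm v)).
    - unfold a, b, Rmax; repeat destruct (Rle_dec _ _);
        unfold Rabs; repeat destruct (Rcase_abs _); lra.
    - exact (norm_triangle_inv (V := ell2_NormedModule) u v). }
  change (norm (minus (scal (r / a) u) (scal (r / b) v)) <= 2 * norm (minus u v)).
  replace (minus (scal (r / a) u) (scal (r / b) v)) with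
    (plus (scal (r / a) (minus u v)) (scal (r / a - r / b) v)).
  2:{ apply ell2_eq; intros n; simpl; rewrite RtoC_minus; ring. }
  eapply Rle_trans; [apply (norm_triangle (V := ell2_NormedModule))|].
  change (norm (scal (r / a) (minus u v)) + norm (scal (r / a - r / b) v)
          <= 2 * norm (minus u v)).
  rewrite !ell2_norm_scal.
  replace (r / a - r / b) with (r / a * ((b - a) * / b)) by (field; lra).
  rewrite !Rabs_mult, (Rabs_pos_eq (/ b)) by (left; apply Rinv_0_lt_compat; lra).
  assert (H1 : 0 <= r / a <= 1).
  { split; [apply Rlt_le, Rdiv_lt_0_compat; lra|].
    apply Rmult_le_reg_r with a; [lra|]; unfold Rdiv; rewrite Rmult_assoc, Rinv_l; lra. }
  assert (H2 : 0 <= / b * norm v <= 1).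
  { split; [apply Rmult_le_pos; [left; apply Rinv_0_lt_compat; lra | apply norm_ge_0]|].
    apply Rmult_le_reg_l with b; [lra|].
    rewrite <- Rmult_assoc, Rinv_r; lra. }
  rewrite (Rabs_pos_eq (r / a)) by apply H1.
  pose proof (Rabs_pos (b - a)); pose proof (norm_ge_0 (minus u v)).
  assert (Rabs (b - a) * (/ b * norm v) <= norm (minus u v)) by nra.
  replace (r / a * (Rabs (b - a) * / b) * norm v) with
    (r / a * (Rabs (b - a) * (/ b * norm v))) by ring.
  assert (0 <= Rabs (b - a) * (/ b * norm v)) by (apply Rmult_le_pos; lra).
  nra.
Qed.

(** Two facts about [N] enter: its Lipschitz constant on the ball and its size at [zero]. The last
    inequality in the hypotheses says that the energy bound on the truncated solution does not leave
    the ball. *)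
Lemma semilinear_flow (N : ell2 -> ell2) (kappa T L n0 r : R) (d x0 : ell2) :
  0 < kappa -> 0 <= T -> 0 < r -> 0 <= L ->
  (forall u v, norm u <= r -> norm v <= r -> ndist (N u) (N v) <= L * ndist u v) ->
  norm (N zero) <= n0 ->
  norm x0 + sqrt (2 * kappa) * norm d * sqrt T + (n0 + L * r) * T <= r ->
  exists Phi : R -> ell2,
    (forall t, continuous Phi t) /\
    (forall t, 0 <= t <= T -> norm (Phi t) <= r) /\
    (forall t, 0 <= t <= T ->
       is_RInt (fun s => plus (lap_field kappa d (Phi s)) (ell2_imul (N (Phi s))))
         0 t (minus (Phi t) x0)).
Proof.
  intros Hk HT Hr HL HN Hn0 Hr0.
  set (h := fun u => ell2_imul (N (ball_retract r u))).
  set (f := fun u => plus (lap_field kappa d u) (h u)).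
  assert (E0 : norm (zero : ell2) = 0) by apply (norm_zero (V := ell2_NormedModule)).
  assert (Hh : forall u, norm (h u) <= n0 + L * r).
  { intros u; unfold h; rewrite norm_imul.
    set (v := ball_retract r u).
    assert (Hv : norm v <= r) by (apply norm_ball_retract, Hr).
    assert (Hz : norm (zero : ell2) <= r) by lra.
    pose proof (HN v zero Hv Hz) as H.
    replace (N v) with (plus (minus (N v) (N zero)) (N zero))
      by (apply ell2_eq; intros n; simpl; ring).
    eapply Rle_trans; [apply (norm_triangle (V := ell2_NormedModule))|].
    rewrite Rplus_comm; apply Rplus_le_compat; [exact Hn0|].
    eapply Rle_trans; [exact H|]; apply Rmult_le_compat_l; [exact HL|].
    change (norm (minus v zero) <= r).
    replace (minus v zero) with v; [exact Hv|].
    apply ell2_eq; intros n; simpl; ring. }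
  assert (Hhl : forall u v, ndist (h u) (h v) <= 2 * L * ndist u v).
  { intros u v; apply Rle_trans with
      (ndist (N (ball_retract r u)) (N (ball_retract r v))).
    - right; unfold h.
      change (norm (minus (ell2_imul (N (ball_retract r u)))
                (ell2_imul (N (ball_retract r v))))
        = norm (minus (N (ball_retract r u)) (N (ball_retract r v)))).
      symmetry; rewrite <- norm_imul; f_equal; apply ell2_eq; intros n; simpl; ring.
    - eapply Rle_trans; [apply HN; apply norm_ball_retract, Hr|].
      pose proof (ball_retract_lipschitz r u v Hr); nra. }
  assert (Hfl : forall u v, ndist (f u) (f v) <= (4 * kappa + 2 * L) * ndist u v).
  { intros u v.
    pose proof (lap_field_lipschitz kappa d u v Hk); pose proof (Hhl u v).
    apply Rle_trans with (ndist (lap_field kappa d u) (lap_field kappa d v)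
                          + ndist (h u) (h v)); [|lra].
    change (norm (minus (f u) (f v)) <=
      norm (minus (lap_field kappa d u) (lap_field kappa d v))
      + norm (minus (h u) (h v))).
    replace (minus (f u) (f v)) with
      (plus (minus (lap_field kappa d u) (lap_field kappa d v)) (minus (h u) (h v)))
      by (apply ell2_eq; intros n; simpl; ring).
    apply (norm_triangle (V := ell2_NormedModule)). }
  assert (Hgl : forall u v, ndist (lap_field kappa d u) (lap_field kappa d v)
      <= 4 * kappa * ndist u v) by (intros; apply lap_field_lipschitz, Hk).
  destruct (picard_ODE (V := ell2_CompleteNormedModule) f (4 * kappa + 2 * L) x0 T
              ltac:(lra) HT Hfl) as [Phi [HPc HPI]].
  destruct (picard_ODE (V := ell2_CompleteNormedModule) (lap_field kappa d)
              (4 * kappa) zero T ltac:(lra) HT Hgl) as [w [Hwc HwI]].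
  change (R -> ell2) in Phi, w.
  assert (Hfc : forall u, continuous f u).
  { intros u; apply (continuous_lipschitz (V := ell2_NormedModule)
      (W := ell2_NormedModule) f (4 * kappa + 2 * L)); [lra | auto]. }
  assert (Hgc : forall u, continuous (lap_field kappa d) u).
  { intros u; apply (continuous_lipschitz (V := ell2_NormedModule)
      (W := ell2_NormedModule) _ (4 * kappa)); [lra | auto]. }
  assert (HPd := fun t => ODE_derive f Phi x0 T t Hfc HPc HPI).
  assert (Hwd := fun t => ODE_derive (lap_field kappa d) w zero T t Hgc Hwc HwI).
  assert (Hinit : forall (g phi : R -> ell2) (y0 : ell2),
    is_RInt g 0 0 (minus (phi 0) y0) -> phi 0 = y0).
  { intros g phi y0 H; apply eq_of_minus_zero.
    apply (filterlim_locally_unique (V := ell2_NormedModule) _ _ _ H).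
    apply (is_RInt_point (V := ell2_NormedModule)). }
  assert (HP0 : Phi 0 = x0) by (apply (Hinit _ _ _ (HPI 0 ltac:(lra)))).
  assert (Hw0 : w 0 = zero) by (apply (Hinit _ _ _ (HwI 0 ltac:(lra)))).
  assert (Hball : forall t, 0 <= t <= T -> norm (Phi t) <= r).
  { intros t Ht.
    pose proof (lap_flow_bound kappa T t d w Hk Hwc Hw0 Hwd Ht) as Hw.
    assert (Hs : sqrt (2 * kappa) * norm d * sqrt t <= sqrt (2 * kappa) * norm d * sqrt T).
    { apply Rmult_le_compat_l.
      - apply Rmult_le_pos; [apply sqrt_pos | apply norm_ge_0].
      - apply sqrt_le_1_alt; lra. }
    assert (Hc0 : 0 <= n0 + L * r) by (pose proof (norm_ge_0 (h zero)); pose proof (Hh zero); lra).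
    (* Subtracting [w] removes the forcing: what remains is a skew linear term, invisible to the
       norm, plus [h (Phi)], which is bounded uniformly. *)
    assert (Hq : norm (minus (Phi t) (w t)) <=
              norm (minus (Phi 0) (w 0)) + (n0 + L * r) * t).
    { apply (norm_growth (fun s => minus (Phi s) (w s))
        (fun s => minus (f (Phi s)) (lap_field kappa d (w s))) _ T); auto.
      - intros s Hs'; apply (is_derive_minus (V := ell2_NormedModule)); auto.
      - intros s; apply (continuous_minus (V := ell2_NormedModule)); auto.
      - intros s Hs'.
        replace (minus (f (Phi s)) (lap_field kappa d (w s))) with
          (plus (minus (lap_field kappa d (Phi s)) (lap_field kappa d (w s)))
             (h (Phi s))) by (apply ell2_eq; intros n; simpl; ring).
        rewrite ell2_inner_plus_r, lap_field_minus, ell2_inner_scal_r, inner_imul_lap.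
        pose proof (ell2_inner_le (minus (Phi s) (w s)) (h (Phi s))).
        pose proof (Hh (Phi s)); pose proof (norm_ge_0 (minus (Phi s) (w s))).
        nra. }
    replace (minus (Phi 0) (w 0)) with x0 in Hq.
    2:{ rewrite HP0, Hw0; apply ell2_eq; intros n; simpl; ring. }
    replace (Phi t) with (plus (minus (Phi t) (w t)) (w t))
      by (apply ell2_eq; intros n; simpl; ring).
    eapply Rle_trans; [apply (norm_triangle (V := ell2_NormedModule))|].
    change (norm (minus (Phi t) (w t)) + norm (w t) <= r).
    assert ((n0 + L * r) * t <= (n0 + L * r) * T) by nra.
    lra. }
  exists Phi; split; [exact HPc|]; split; [exact Hball|].
  intros t Ht; apply (is_RInt_ext (fun s => f (Phi s))); [|apply HPI, Ht].
  rewrite Rmin_left, Rmax_right by apply Ht; intros s Hs.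
  unfold f, h; rewrite ball_retract_id; [reflexivity | exact Hr | apply Hball; lra].
Qed.

(** * The nonlinearity and the scaling *)

Lemma rpow_Rpower (x a : R) : 0 < x -> rpow x a = Rpower x a.
Proof. intros Hx; unfold rpow; destruct (Req_EM_T x 0); [lra | reflexivity]. Qed.

(** At [x = 0] the convention for [rpow] matters: for exponent 0, which occurs when [p = 1], both
    sides are 1; for a positive exponent the left side is 0. *)
Lemma rpow_le_Rpower (x y a : R) : 0 <= a -> 0 <= x <= y -> 0 < y ->
  rpow x a <= Rpower y a.
Proof.
  intros Ha Hx Hy; unfold rpow; destruct (Req_EM_T x 0) as [E|E].
  - destruct (Req_EM_T a 0) as [E'|E'].
    + rewrite E', Rpower_O by exact Hy; lra.
    + left; apply exp_pos.
  - apply Rle_Rpower_l; [exact Ha | lra].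
Qed.

(** Here [s] bounds moduli while [F] acts on squared moduli, so the power [p - 1] of the argument
    becomes [2 p - 2] of [s]. *)
Lemma F_cond_lipschitz (p K s x y : R) (F : R -> R) : 1 <= p -> 0 < K -> 0 < s ->
  F_cond p K F -> 0 <= x <= s ^ 2 -> 0 <= y <= s ^ 2 ->
  Rabs (F x - F y) <= 2 * K * Rpower s (2 * p - 2) * Rabs (x - y).
Proof.
  intros Hp HK Hs [_ [HF _]] Hx Hy.
  assert (Hs2 : 0 < s ^ 2) by (apply pow_lt, Hs).
  assert (E : Rpower (s ^ 2) (p - 1) = Rpower s (2 * p - 2)).
  { rewrite <- Rpower_pow, Rpower_mult by exact Hs; f_equal; simpl; ring. }
  eapply Rle_trans; [apply HF; tauto|].
  apply Rmult_le_compat_r; [apply Rabs_pos|].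
  rewrite !Rabs_pos_eq by tauto.
  pose proof (rpow_le_Rpower x (s ^ 2) (p - 1) ltac:(lra) Hx Hs2).
  pose proof (rpow_le_Rpower y (s ^ 2) (p - 1) ltac:(lra) Hy Hs2).
  rewrite <- E; nra.
Qed.

Lemma Rpower_mul_sqr (s p : R) : 0 < s ->
  Rpower s (2 * p - 2) * s ^ 2 = Rpower s (2 * p).
Proof.
  intros Hs; rewrite <- Rpower_pow, <- Rpower_plus by exact Hs; f_equal; simpl; ring.
Qed.

Definition nonlin (gamma q0 : R) (F : R -> R) (a : C) : C :=
  (RtoC (gamma * (F (Cmod a ^ 2) - F (q0 ^ 2)))%R * a)%C.

Lemma Cmod_sqr_minus_le (a b : C) :
  Rabs (Cmod a ^ 2 - Cmod b ^ 2) <= Cmod (a - b) * (Cmod a + Cmod b).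
Proof.
  replace (Cmod a ^ 2 - Cmod b ^ 2) with ((Cmod a - Cmod b) * (Cmod a + Cmod b)) by ring.
  pose proof (Cmod_ge_0 a); pose proof (Cmod_ge_0 b).
  rewrite Rabs_mult, (Rabs_pos_eq (Cmod a + Cmod b)) by lra.
  apply Rmult_le_compat_r; [lra|].
  pose proof (Cmod_triangle (a - b) b) as H1; pose proof (Cmod_triangle (b - a) a) as H2.
  replace (a - b + b)%C with a in H1 by ring.
  replace (b - a + a)%C with b in H2 by ring.
  replace (Cmod (b - a)) with (Cmod (a - b)) in H2
    by (rewrite <- Cmod_opp; f_equal; ring).
  apply Rabs_le; lra.
Qed.

(** The constant 6 is 2 + 4: a coefficient of size at most [2 K s^(2p)] times [a - b], plus a
    difference of coefficients times [b], where the difference of squared moduli costs another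
    factor [2 s]. *)
Lemma nonlin_lipschitz (p K gamma q0 s : R) (F : R -> R) (a b : C) :
  1 <= p -> 0 < K -> 0 < s -> F_cond p K F -> 0 <= q0 <= s ->
  Cmod a <= s -> Cmod b <= s ->
  Cmod (nonlin gamma q0 F a - nonlin gamma q0 F b)
  <= 6 * Rabs gamma * K * Rpower s (2 * p) * Cmod (a - b).
Proof.
  intros Hp HK Hs HF Hq Ha Hb.
  pose proof (Cmod_ge_0 a) as Ha0; pose proof (Cmod_ge_0 b) as Hb0.
  pose proof (Cmod_ge_0 (a - b)) as Hab0.
  assert (Hsq : forall x, 0 <= x <= s -> 0 <= x ^ 2 <= s ^ 2).
  { intros x Hx; split; [apply pow2_ge_0 | apply pow_incr; exact Hx]. }
  assert (Haq := F_cond_lipschitz p K s (Cmod a ^ 2) (q0 ^ 2) F Hp HK Hs HF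
                   (Hsq _ (conj Ha0 Ha)) (Hsq _ Hq)).
  assert (Hab := F_cond_lipschitz p K s (Cmod a ^ 2) (Cmod b ^ 2) F Hp HK Hs HF
                   (Hsq _ (conj Ha0 Ha)) (Hsq _ (conj Hb0 Hb))).
  rewrite <- Rpower_mul_sqr by exact Hs.
  assert (HE : 0 < Rpower s (2 * p - 2)) by apply exp_pos.
  set (E := Rpower s (2 * p - 2)) in *.
  assert (HKE : 0 < K * E) by (apply Rmult_lt_0_compat; assumption).
  assert (H1 : Rabs (F (Cmod a ^ 2) - F (q0 ^ 2)) <= 2 * (K * E) * s ^ 2).
  { assert (Rabs (Cmod a ^ 2 - q0 ^ 2) <= s ^ 2); [|nra].
    pose proof (Hsq _ (conj Ha0 Ha)); pose proof (Hsq _ Hq); apply Rabs_le; lra. }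
  assert (H2 : Rabs (F (Cmod a ^ 2) - F (Cmod b ^ 2))
               <= 4 * (K * E) * s * Cmod (a - b)).
  { eapply Rle_trans; [exact Hab|].
    replace (4 * (K * E) * s * Cmod (a - b)) with
      (2 * K * E * (Cmod (a - b) * (2 * s))) by ring.
    apply Rmult_le_compat_l; [nra|].
    eapply Rle_trans; [apply Cmod_sqr_minus_le|].
    apply Rmult_le_compat_l; lra. }
  replace (nonlin gamma q0 F a - nonlin gamma q0 F b)%C with
    (RtoC (gamma * (F (Cmod a ^ 2) - F (q0 ^ 2)))%R * (a - b)
     + RtoC (gamma * (F (Cmod a ^ 2) - F (Cmod b ^ 2)))%R * b)%C.
  2:{ unfold nonlin; rewrite !RtoC_mult, !RtoC_minus; ring. }
  eapply Rle_trans; [apply Cmod_triangle|].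
  rewrite !Cmod_mult, !Cmod_R, !Rabs_mult.
  pose proof (Rabs_pos gamma) as Hg.
  set (X := Rabs (F (Cmod a ^ 2) - F (q0 ^ 2))) in *.
  set (Y := Rabs (F (Cmod a ^ 2) - F (Cmod b ^ 2))) in *.
  assert (HY0 : 0 <= Y) by apply Rabs_pos.
  assert (G1 : X * Cmod (a - b) <= 2 * (K * E) * s ^ 2 * Cmod (a - b))
    by (apply Rmult_le_compat_r; assumption).
  assert (G2 : Y * Cmod b <= 4 * (K * E) * s * Cmod (a - b) * s)
    by (apply Rmult_le_compat; assumption).
  assert (G : X * Cmod (a - b) + Y * Cmod b <= 6 * (K * E) * s ^ 2 * Cmod (a - b)) by lra.
  apply (Rmult_le_compat_l _ _ _ Hg) in G; lra.
Qed.

(** The factor [Cmod a - q0] is kept rather than bounded by [s]: it is what is square summable when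
    [a] runs through [zeta]. The remaining factors [Cmod a + q0] and [Cmod a] raise [s^(2p-2)] to
    [s^(2p)]. *)
Lemma nonlin_le (p K gamma q0 s : R) (F : R -> R) (a : C) :
  1 <= p -> 0 < K -> 0 < s -> F_cond p K F -> 0 <= q0 -> Cmod a + q0 <= s ->
  Cmod (nonlin gamma q0 F a)
  <= 2 * Rabs gamma * K * Rpower s (2 * p) * Cmod (RtoC (Cmod a - q0)).
Proof.
  intros Hp HK Hs HF Hq Ha.
  pose proof (Cmod_ge_0 a) as Ha0; pose proof (Rabs_pos gamma) as Hg.
  assert (Hsq : forall x, 0 <= x <= s -> 0 <= x ^ 2 <= s ^ 2).
  { intros x Hx; split; [apply pow2_ge_0 | apply pow_incr; exact Hx]. }
  assert (Haq := F_cond_lipschitz p K s (Cmod a ^ 2) (q0 ^ 2) F Hp HK Hs HF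
                   (Hsq (Cmod a) ltac:(lra)) (Hsq q0 ltac:(lra))).
  rewrite <- Rpower_mul_sqr by exact Hs.
  unfold nonlin; rewrite Cmod_mult, !Cmod_R, Rabs_mult.
  assert (HE : 0 < Rpower s (2 * p - 2)) by apply exp_pos.
  set (E := Rpower s (2 * p - 2)) in *.
  assert (HKE : 0 < K * E) by (apply Rmult_lt_0_compat; assumption).
  replace (Cmod a ^ 2 - q0 ^ 2) with ((Cmod a - q0) * (Cmod a + q0)) in Haq by ring.
  rewrite Rabs_mult, (Rabs_pos_eq (Cmod a + q0)) in Haq by lra.
  set (D := Rabs (Cmod a - q0)) in *.
  assert (HD : 0 <= D) by apply Rabs_pos.
  set (X := Rabs (F (Cmod a ^ 2) - F (q0 ^ 2))) in *.
  assert (G1 : D * (Cmod a + q0) <= D * s) by (apply Rmult_le_compat_l; lra).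
  assert (G2 : X <= 2 * (K * E) * (D * s)) by nra.
  assert (G3 : X * Cmod a <= 2 * (K * E) * (D * s) * s).
  { apply Rmult_le_compat; try lra; apply Rabs_pos. }
  apply (Rmult_le_compat_l _ _ _ Hg) in G3; lra.
Qed.

(** * The nonlinearity as a map of [ell2] *)

Lemma l2norm_compare (u v : Z -> C) (c : R) :
  0 <= c -> in_ell2 v -> (forall n, Cmod (u n) <= c * Cmod (v n)) ->
  in_ell2 u /\ l2norm u <= c * l2norm v.
Proof.
  intros Hc Hv H.
  pose proof (in_ell2_scal (RtoC c) v Hv) as Hcv.
  assert (Hle : forall n, 0 <= Cmod (u n) ^ 2 <= Cmod (RtoC c * v n)%C ^ 2).
  { intros n; split; [apply pow2_ge_0|].
    rewrite Cmod_mult, Cmod_R, Rabs_pos_eq by exact Hc.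
    apply pow_incr; split; [apply Cmod_ge_0 | apply H]. }
  split.
  - apply (ex_seriesZ_le _ _ Hle Hcv).
  - rewrite <- (Rabs_pos_eq c), <- Cmod_R, <- l2norm_scal by assumption.
    apply sqrt_le_1_alt, SeriesZ_le; assumption.
Qed.

Lemma Cmod_le_linfnorm (z : Z -> C) (n : Z) : in_ellinf z -> Cmod (z n) <= linfnorm z.
Proof.
  intros [M HM].
  pose proof (Lub_Rbar_correct (fun x => exists n : Z, x = Cmod (z n))) as [H1 H2].
  (* [real] sends infinite values to 0, so they must be excluded: the upper one by boundedness, the
     lower one because the set is not empty. *)
  unfold linfnorm; destruct (Lub_Rbar _) as [l| |].
  - exact (H1 (Cmod (z n)) (ex_intro _ n eq_refl)).
  - exfalso; apply (H2 (Finite M)); intros x [m ->]; apply HM.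
  - exfalso; exact (H1 (Cmod (z n)) (ex_intro _ n eq_refl)).
Qed.

(** The value at [z] is dominated by [mod_defect z q0], and the increment from [z] to [u + z] by
    [u]. *)
Lemma nonlin_shift_in_ell2 (p K gamma q0 : R) (F : R -> R) (z : Z -> C) (u : ell2) :
  1 <= p -> 0 < K -> F_cond p K F -> 0 < q0 ->
  in_ellinf z -> in_ell2 (mod_defect z q0) ->
  in_ell2 (fun n => nonlin gamma q0 F (u n + z n)).
Proof.
  intros Hp HK HF Hq Hz HD.
  assert (Hl : 0 <= linfnorm z).
  { eapply Rle_trans; [apply (Cmod_ge_0 (z 0%Z)) | apply Cmod_le_linfnorm, Hz]. }
  assert (Hu : 0 <= norm u) by apply norm_ge_0.
  pose proof (Rabs_pos gamma) as Hg.
  assert (H0 : in_ell2 (fun n => nonlin gamma q0 F (z n))).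
  { apply (l2norm_compare _ (mod_defect z q0)
      (2 * Rabs gamma * K * Rpower (linfnorm z + q0) (2 * p))); [|exact HD|].
    - repeat apply Rmult_le_pos; try lra; left; apply exp_pos.
    - intros n; apply nonlin_le; auto; try lra.
      pose proof (Cmod_le_linfnorm z n Hz); lra. }
  assert (H1 : in_ell2 (fun n => nonlin gamma q0 F (u n + z n) - nonlin gamma q0 F (z n))%C).
  { apply (l2norm_compare _ u
      (6 * Rabs gamma * K * Rpower (norm u + linfnorm z + q0) (2 * p)));
      [|apply ell2_prop|].
    - repeat apply Rmult_le_pos; try lra; left; apply exp_pos.
    - intros n.
      pose proof (Cmod_le_linfnorm z n Hz) as Hzn.
      pose proof (l2norm_term u n (ell2_prop u)) as Hun; change (l2norm u) with (norm u) in Hun.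
      pose proof (Cmod_triangle (u n) (z n)).
      eapply Rle_trans; [apply (nonlin_lipschitz p K gamma q0 (norm u + linfnorm z + q0) F
        (u n + z n) (z n)); auto; lra|].
      right; do 2 f_equal; ring. }
  replace (fun n => nonlin gamma q0 F (u n + z n)) with
    (fun n => nonlin gamma q0 F (u n + z n) - nonlin gamma q0 F (z n)
              + nonlin gamma q0 F (z n))%C.
  - apply in_ell2_plus; assumption.
  - apply functional_extensionality; intros n; ring.
Qed.

Lemma ell2_limZ (u : ell2) : limZ_pinf u 0 /\ limZ_minf u 0.
Proof.
  assert (Hc : forall v : nat -> C, ex_series (fun n => Cmod (v n) ^ 2) ->
             filterlim v eventually (locally (RtoC 0))).
  { intros v Hv; apply filterlim_locally; intros e.
    assert (He : 0 < e ^ 2) by (apply pow_lt, cond_pos).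
    pose proof (ex_series_lim_0 _ Hv) as H.
    destruct (proj2 (is_lim_seq_spec _ 0) H (mkposreal _ He)) as [N HN].
    exists N; intros n Hn; specialize (HN n Hn); simpl in HN.
    apply (@norm_compat1 C_AbsRing C_NormedModule).
    change (Cmod (v n - 0)%C < e).
    replace (v n - 0)%C with (v n) by ring.
    rewrite Rminus_0_r in HN; apply Rle_lt_trans with (1 := Rle_abs _) in HN.
    destruct (Rlt_le_dec (Cmod (v n)) e) as [Hl|Hl]; [exact Hl|].
    exfalso; pose proof (cond_pos e); nra. }
  destruct (ell2_prop u) as [H1 H2]; split.
  - apply (Hc (fun n => u (Z.of_nat n))), H1.
  - apply (Hc (fun n => u (- Z.of_nat n)%Z)).
    (* [limZ_minf] runs from index 0, while the negative half of the series starts at -1. *)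
    apply (ex_series_incr_1 (V := R_NormedModule)
             (fun n => Cmod (u (- Z.of_nat n)%Z) ^ 2)), H2.
Qed.

Lemma CT_norm_le (T M : R) (Phi : R -> ell2) :
  Rbar_le (CT_norm T Phi) M <-> (forall t, 0 <= t <= T -> norm (Phi t) <= M).
Proof.
  unfold CT_norm; set (P := fun x => exists t : R, 0 <= t <= T /\ x = norm (Phi t)).
  pose proof (Lub_Rbar_correct P) as [H1 H2]; split.
  - intros H t Ht.
    exact (Rbar_le_trans (norm (Phi t)) _ M (H1 _ (ex_intro _ t (conj Ht eq_refl))) H).
  - intros H; apply H2; intros x [t [Ht ->]]; exact (H t Ht).
Qed.

Lemma is_RInt_point_eq (g phi : R -> ell2) (x0 : ell2) :
  is_RInt g 0 0 (minus (phi 0) x0) -> phi 0 = x0.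
Proof.
  intros H; apply eq_of_minus_zero.
  apply (filterlim_locally_unique (V := ell2_NormedModule) _ _ _ H).
  apply (is_RInt_point (V := ell2_NormedModule)).
Qed.

(** * Local well-posedness *)

(** The constant in [rho] has to absorb the 2 of [nonlin_le], and twice it, in the lifespan
    condition, has to absorb the 6 of [nonlin_lipschitz] with a factor 2 to spare. The value 8
    covers both. *)
Lemma Rpower_2_ge_8 (p : R) : 1 <= p -> 8 <= Rpower 2 (2 * p + 3 / 2).
Proof.
  intros Hp; replace 8 with (Rpower 2 3).
  - apply Rle_Rpower; lra.
  - replace 3 with (INR 3) by (simpl; ring); rewrite Rpower_pow by lra; ring.
Qed.

(** Existence comes from [semilinear_flow] with radius [rho(T)]. Uniqueness compares the untruncated
    equations directly, since both curves stay in the ball where the nonlinearity is Lipschitz. *)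
Lemma local_wellposedness (p kappa gamma K q0 T : R) (F : R -> R) (Phi0 : ell2)
    (z : Z -> C) :
  1 <= p -> 0 < kappa -> 0 < K -> 0 < q0 -> 0 <= T -> 0 < norm Phi0 ->
  F_cond p K F -> in_X1 z -> in_ell2 (mod_defect z q0) ->
  min_lifespan p kappa gamma K q0 Phi0 z T ->
  exists Phi : R -> ell2,
    is_solution kappa gamma q0 F z Phi0 T Phi /\
    Rbar_le (CT_norm T Phi) (rho p kappa gamma K q0 Phi0 z T) /\
    (forall Psi : R -> ell2,
       is_solution kappa gamma q0 F z Phi0 T Psi ->
       Rbar_le (CT_norm T Psi) (rho p kappa gamma K q0 Phi0 z T) ->
       forall t, 0 <= t <= T -> Psi t = Phi t).
Proof.
  intros Hp Hk HK Hq HT HP0 HF [Hz Hbz] HD Hlife.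
  set (r := rho p kappa gamma K q0 Phi0 z T) in *.
  set (N := fun u : ell2 => Ell2 (fun n => nonlin gamma q0 F (u n + z n))
    (nonlin_shift_in_ell2 p K gamma q0 F z u Hp HK HF Hq Hz HD)).
  set (d := Ell2 (bdiff z) Hbz).
  set (S := linfnorm z + q0).
  set (D := l2norm (mod_defect z q0)).
  set (n0 := 2 * Rabs gamma * K * Rpower S (2 * p) * D).
  set (L := 6 * Rabs gamma * K * Rpower (r + linfnorm z + q0) (2 * p)).
  assert (Hg : 0 <= Rabs gamma) by apply Rabs_pos.
  assert (HgK : 0 <= Rabs gamma * K) by (apply Rmult_le_pos; lra).
  assert (Hl : 0 <= linfnorm z).
  { eapply Rle_trans; [apply (Cmod_ge_0 (z 0%Z)) | apply Cmod_le_linfnorm, Hz]. }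
  assert (HD0 : 0 <= D) by apply l2norm_pos.
  pose proof (Rpower_2_ge_8 p Hp) as H8.
  set (c := Rpower 2 (2 * p + 3 / 2)) in *.
  assert (Ec : Rpower 2 (2 * p + 5 / 2) = 2 * c).
  { unfold c; replace (2 * p + 5 / 2) with (1 + (2 * p + 3 / 2)) by field.
    rewrite Rpower_plus, Rpower_1; lra. }
  set (X := sqrt (2 * kappa) * l2norm (bdiff z) * sqrt T).
  assert (HX : 0 <= X).
  { unfold X; repeat apply Rmult_le_pos; apply sqrt_pos || apply l2norm_pos. }
  set (Y := c * Rabs gamma * K * Rpower (linfnorm z + D + q0) (2 * p + 1) * T).
  assert (HY : 0 <= Y).
  { unfold Y; rewrite (Rmult_assoc c).
    repeat apply Rmult_le_pos; try lra; left; apply exp_pos. }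
  assert (Er : r = 2 * (norm Phi0 + X + Y)).
  { unfold r, rho; rewrite rpow_Rpower by (fold D; lra); reflexivity. }
  assert (Hr : 0 < r) by lra.
  assert (Hn0T : n0 * T <= Y).
  { unfold Y; apply Rmult_le_compat_r; [exact HT|].
    assert (E : Rpower (linfnorm z + D + q0) (2 * p + 1)
      = Rpower (linfnorm z + D + q0) (2 * p) * (linfnorm z + D + q0)).
    { rewrite Rpower_plus, Rpower_1 by lra; reflexivity. }
    assert (Hm : Rpower S (2 * p) <= Rpower (linfnorm z + D + q0) (2 * p)).
    { apply Rle_Rpower_l; unfold S; lra. }
    assert (Hm' : Rpower S (2 * p) * D <= Rpower (linfnorm z + D + q0) (2 * p + 1)).
    { rewrite E; apply Rmult_le_compat; try lra; left; apply exp_pos. }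
    assert (0 <= Rpower S (2 * p) * D)
      by (apply Rmult_le_pos; [left; apply exp_pos | exact HD0]).
    unfold n0.
    replace (2 * Rabs gamma * K * Rpower S (2 * p) * D) with
      (2 * ((Rabs gamma * K) * (Rpower S (2 * p) * D))) by ring.
    replace (c * Rabs gamma * K * Rpower (linfnorm z + D + q0) (2 * p + 1)) with
      (c * ((Rabs gamma * K) * Rpower (linfnorm z + D + q0) (2 * p + 1))) by ring.
    apply Rmult_le_compat; try lra.
    - apply Rmult_le_pos; assumption.
    - apply Rmult_le_compat_l; assumption. }
  assert (HL0 : 0 <= L).
  { unfold L; repeat apply Rmult_le_pos; try lra; left; apply exp_pos. }
  assert (HLT : L * T <= 1 / 2).
  { unfold min_lifespan in Hlife; fold r in Hlife.
    rewrite rpow_Rpower, Ec in Hlife by lra.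
    unfold L; set (E := Rpower (r + linfnorm z + q0) (2 * p)) in *.
    assert (0 <= Rabs gamma * K * E * T).
    { repeat apply Rmult_le_pos; try lra; left; apply exp_pos. }
    nra. }
  assert (HNL : forall u v : ell2, norm u <= r -> norm v <= r ->
    ndist (N u) (N v) <= L * ndist u v).
  { intros u v Hu Hv.
    apply (l2norm_compare (minus (N u) (N v)) (minus u v) L HL0 (ell2_prop _)).
    intros n; simpl.
    pose proof (Cmod_le_linfnorm z n Hz) as Hzn.
    pose proof (l2norm_term u n (ell2_prop u)) as Hun; change (l2norm u) with (norm u) in Hun.
    pose proof (l2norm_term v n (ell2_prop v)) as Hvn; change (l2norm v) with (norm v) in Hvn.
    pose proof (Cmod_triangle (u n) (z n)); pose proof (Cmod_triangle (v n) (z n)).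
    change (Cmod (nonlin gamma q0 F (u n + z n) - nonlin gamma q0 F (v n + z n))
      <= L * Cmod (u n - v n)).
    replace (u n - v n)%C with ((u n + z n) - (v n + z n))%C by ring.
    apply nonlin_lipschitz; auto; lra. }
  assert (HN0 : norm (N zero) <= n0).
  { apply (l2norm_compare (N zero) (mod_defect z q0)
      (2 * Rabs gamma * K * Rpower S (2 * p))); [|exact HD|].
    - repeat apply Rmult_le_pos; try lra; left; apply exp_pos.
    - intros n; simpl; rewrite Cplus_0_l; apply nonlin_le; auto; unfold S; try lra.
      pose proof (Cmod_le_linfnorm z n Hz); lra. }
  destruct (semilinear_flow N kappa T L n0 r d Phi0 Hk HT Hr HL0 HNL HN0)
    as [Phi [HPc [HPb HPI]]].
  (* Since [n0 T <= Y] and [L T <= 1/2], the left side is at most [norm Phi0 + X + Y + r / 2], which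
     equals [r]. *)
  { change (norm d) with (l2norm (bdiff z)); fold X; nra. }
  (* [V] is the right-hand side in the form [i Phi' + V = 0]; multiplying by [i] gives the form
     [Phi' = i V] that the flow solves. *)
  set (V := fun u : ell2 => plus (scal kappa (fdiff (plus (ell2_bdiff u) d))) (N u)).
  assert (HVop : forall (u : ell2) n, V u n = gdnls_op kappa gamma q0 F z u n).
  { intros u n.
    change (RtoC kappa * fdiff (plus (ell2_bdiff u) d) n + nonlin gamma q0 F (u n + z n)
      = gdnls_op kappa gamma q0 F z u n)%C.
    unfold gdnls_op, nonlin; do 2 f_equal; simpl; unfold lap, bdiff.
    replace (n + 1 - 1)%Z with n by lia; ring. }
  assert (HiV : forall u : ell2,
    ell2_imul (V u) = plus (lap_field kappa d u) (ell2_imul (N u))).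
  { intros u; apply ell2_eq; intros n; simpl; ring. }
  assert (Hii : forall u : ell2, opp (ell2_imul (ell2_imul u)) = u).
  { intros u; apply ell2_eq; intros n; simpl.
    replace (- (Ci * (Ci * u n)))%C with (- (Ci * Ci) * u n)%C by ring.
    replace (Ci * Ci)%C with (RtoC (-1)) by (apply injective_projections; simpl; ring).
    rewrite <- RtoC_opp; replace (- -1) with 1 by ring; ring. }
  exists Phi; split; [|split].
  - split; [|split; [|split]].
    + intros t _; apply (filterlim_filter_le_1 (F := locally t)); [|apply HPc].
      intros P HP; exact (filter_le_within _ P HP).
    + apply (is_RInt_point_eq _ _ _ (HPI 0 (conj (Rle_refl 0) HT))).
    + intros t _; apply ell2_limZ.
    (* The field [i V] integrates to [Phi(t) - Phi0]; multiplying by [- i] recovers [V] and gives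
       the integral [- i (Phi(t) - Phi0)]. *)
    + exists (fun s => V (Phi s)); split; [intros s _ n; apply HVop|].
      intros t Ht; exists (opp (ell2_imul (minus (Phi t) Phi0))); split.
      * apply (is_RInt_ext (V := ell2_NormedModule)
          (fun s => opp (ell2_imul (plus (lap_field kappa d (Phi s)) (ell2_imul (N (Phi s))))))).
        { intros s _; rewrite <- HiV; apply Hii. }
        apply (is_RInt_opp (V := ell2_NormedModule)).
        apply (is_RInt_linear (U := ell2_NormedModule) (V := ell2_NormedModule) ell2_imul).
        -- apply is_linear_imul.
        -- apply HPI, Ht.
      * intros n; simpl; ring.
  - apply CT_norm_le, HPb.
  - intros Psi [_ [_ [_ [G [HG HGI]]]]] HPsi.
    pose proof (proj1 (CT_norm_le T r Psi) HPsi) as HPsib.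
    (* The starting bound [2 * r] is the diameter of the ball containing both curves. *)
    apply (ODE_unique (V := ell2_NormedModule) Psi Phi (fun s => ell2_imul (G s))
      (fun s => plus (lap_field kappa d (Phi s)) (ell2_imul (N (Phi s)))) Phi0
      (4 * kappa + L) (2 * r)).
    + lra.
    + intros t Ht; destruct (HGI t Ht) as [J [HJ HJ']].
      assert (EJ : ell2_imul J = minus (Psi t) Phi0).
      { rewrite <- (Hii (minus (Psi t) Phi0)).
        apply ell2_eq; intros n; specialize (HJ' n); simpl.
        replace (J n) with (- (Ci * (Psi t n - Phi0 n)))%C; [ring|].
        rewrite <- (Cplus_0_r (- _)), <- HJ'; ring. }
      refine (eq_ind _ (is_RInt _ 0 t) _ _ EJ).
      exact (is_RInt_linear (U := ell2_NormedModule) (V := ell2_NormedModule)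
          ell2_imul _ _ _ _ is_linear_imul HJ).
    + exact HPI.
    + intros t Ht; change (norm (minus (Psi t) (Phi t)) <= 2 * r).
      pose proof (ell2_norm_minus_le (Psi t) (Phi t)).
      pose proof (HPb t Ht); pose proof (HPsib t Ht); lra.
    + intros t Ht.
      assert (EG : ell2_imul (G t) = plus (lap_field kappa d (Psi t)) (ell2_imul (N (Psi t)))).
      { rewrite <- HiV; f_equal; apply ell2_eq; intros n.
        rewrite HVop; apply HG, Ht. }
      rewrite EG.
      pose proof (lap_field_lipschitz kappa d (Psi t) (Phi t) Hk) as H1.
      pose proof (HNL (Psi t) (Phi t) (HPsib t Ht) (HPb t Ht)) as H2.
      apply Rle_trans with (ndist (lap_field kappa d (Psi t)) (lap_field kappa d (Phi t))
        + ndist (N (Psi t)) (N (Phi t))); [|lra].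
      change (norm (minus (plus (lap_field kappa d (Psi t)) (ell2_imul (N (Psi t))))
                 (plus (lap_field kappa d (Phi t)) (ell2_imul (N (Phi t)))))
        <= norm (minus (lap_field kappa d (Psi t)) (lap_field kappa d (Phi t)))
           + norm (minus (N (Psi t)) (N (Phi t)))).
      rewrite <- (norm_imul (minus (N (Psi t)) (N (Phi t)))).
      match goal with |- norm ?a <= norm ?b + norm ?c =>
        replace a with (plus b c) by (apply ell2_eq; intros n; simpl; ring) end.
      apply (norm_triangle (V := ell2_NormedModule)).
Qed.

(** * Scaling in [eps] and the two directions *)

(** The exponent [p + 1] on [zeta'] is what fits: [eps^(p+1) sqrt T] equals [eps] times the square
    root of [eps^(2p) T], just as the cubic-type term [eps^(2p+1) T] equals [eps] times
    [eps^(2p) T]. *)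
Lemma rho_scaling (p kappa gamma K A0 B B0 B1 B2 eps q0 T : R) (Phi0 : ell2)
    (z : Z -> C) (zm zp : C) :
  0 < eps -> 0 < B -> 0 < B0 -> 0 < B2 -> 0 <= T ->
  data_cond p eps A0 B B0 B1 B2 q0 Phi0 z zm zp ->
  rho p kappa gamma K q0 Phi0 z T =
    2 * (A0 + sqrt (2 * kappa) * B1 * sqrt (Rpower eps (2 * p) * T)
         + Rpower 2 (2 * p + 3 / 2) * Rabs gamma * K
           * Rpower (B0 + B2 + B) (2 * p + 1) * (Rpower eps (2 * p) * T)) * eps.
Proof.
  intros He HB HB0 HB2 HT (E1 & _ & _ & _ & _ & _ & E2 & E3 & E4 & _ & E5).
  unfold rho; rewrite E1, E3, E4, E5, E2.
  replace (B0 * eps + B2 * eps + B * eps) with ((B0 + B2 + B) * eps) by ring.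
  rewrite rpow_Rpower by (apply Rmult_lt_0_compat; lra).
  rewrite <- Rpower_mult_distr by lra.
  rewrite (Rpower_plus (2 * p) 1 eps), (Rpower_plus p 1 eps), Rpower_1 by exact He.
  replace (Rpower eps (2 * p)) with (Rpower eps p ^ 2).
  2:{ rewrite <- Rpower_pow, Rpower_mult by apply exp_pos; f_equal; simpl; ring. }
  rewrite (sqrt_mult (_ ^ 2) T) by (apply pow2_ge_0 || exact HT).
  rewrite sqrt_pow2 by (left; apply exp_pos).
  ring.
Qed.

Theorem theorem3p1 (p kappa gamma K A0 B B0 B1 B2 : R)
    (hp : 1 <= p) (hkappa : 0 < kappa) (hK : 0 < K) (hA0 : 0 < A0)
    (hB : 0 < B) (hB0 : 0 < B0) (hB1 : 0 < B1) (hB2 : 0 < B2) :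
  (forall C0 : R, 0 < C0 ->
     exists A : R, 0 < A /\
       forall (eps q0 T : R) (F : R -> R) (Phi0 : ell2) (z : Z -> C) (zm zp : C),
         0 < eps -> F_cond p K F ->
         data_cond p eps A0 B B0 B1 B2 q0 Phi0 z zm zp ->
         T = C0 / Rpower eps (2 * p) ->
         min_lifespan p kappa gamma K q0 Phi0 z T ->
         exists Phi : R -> ell2,
           is_solution kappa gamma q0 F z Phi0 T Phi /\
           Rbar_le (CT_norm T Phi) (rho p kappa gamma K q0 Phi0 z T) /\
           (forall Psi : R -> ell2,
              is_solution kappa gamma q0 F z Phi0 T Psi ->
              Rbar_le (CT_norm T Psi) (rho p kappa gamma K q0 Phi0 z T) ->
              forall t, 0 <= t <= T -> Psi t = Phi t) /\
           Rbar_le (CT_norm T Phi) (A * eps)) /\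
  (forall A : R, 0 < A ->
     exists C0 : R, 0 < C0 /\
       forall (eps q0 T : R) (F : R -> R) (Phi0 : ell2) (z : Z -> C) (zm zp : C),
         0 < eps -> F_cond p K F ->
         data_cond p eps A0 B B0 B1 B2 q0 Phi0 z zm zp ->
         0 < T ->
         rho p kappa gamma K q0 Phi0 z T = A * eps ->
         min_lifespan p kappa gamma K q0 Phi0 z T ->
         T = C0 / Rpower eps (2 * p)).
Proof.
  set (a := sqrt (2 * kappa) * B1).
  set (b := Rpower 2 (2 * p + 3 / 2) * Rabs gamma * K * Rpower (B0 + B2 + B) (2 * p + 1)).
  assert (ha : 0 < a) by (apply Rmult_lt_0_compat; [apply sqrt_lt_R0; lra | exact hB1]).
  assert (hb : 0 <= b).
  { unfold b; repeat apply Rmult_le_pos; try (left; apply exp_pos); [apply Rabs_pos | lra]. }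
  split.
  (* [A] is the value of [rho(T) / eps] at [eps^(2p) T = C0], so the bound by [A eps] is the ball
     bound itself. *)
  - intros C0 hC0; exists (2 * (A0 + a * sqrt C0 + b * C0)); split.
    { pose proof (sqrt_pos C0); nra. }
    intros eps q0 T F Phi0 z zm zp heps hF hdata hT hlife.
    assert (hR : 0 < Rpower eps (2 * p)) by apply exp_pos.
    assert (hT0 : 0 <= T) by (rewrite hT; left; apply Rdiv_lt_0_compat; assumption).
    pose proof (rho_scaling p kappa gamma K A0 B B0 B1 B2 eps q0 T Phi0 z zm zp
                  heps hB hB0 hB2 hT0 hdata) as Hrho.
    replace (Rpower eps (2 * p) * T) with C0 in Hrho by (rewrite hT; field; lra).
    destruct hdata as (E1 & hX1 & _ & _ & _ & _ & E2 & _ & _ & hD & _).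
    destruct (local_wellposedness p kappa gamma K q0 T F Phi0 z) as [Phi [H1 [H2 H3]]];
      auto.
    { rewrite E2; apply Rmult_lt_0_compat; assumption. }
    { rewrite E1; apply Rmult_lt_0_compat; assumption. }
    exists Phi; split; [exact H1|]; split; [exact H2|]; split; [exact H3|].
    fold a b in Hrho; rewrite <- Hrho; exact H2.
  - intros A hA.
    (* [C0] is the positive root of [2 (A0 + a sqrt X + b X) = A], fixed before [eps]. It is unique
       because [a > 0] makes the left side strictly increasing even when [gamma = 0] gives [b = 0].
       If there is no positive root, no admissible [T] exists and the value 1 serves vacuously. *)
    assert (hx : exists C0, 0 < C0 /\ forall X, 0 < X ->
              2 * (A0 + a * sqrt X + b * X) = A -> X = C0).
    { destruct (classic (exists C0, 0 < C0 /\ 2 * (A0 + a * sqrt C0 + b * C0) = A))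
        as [[C0 [hC0 EC0]]|hno].
      - exists C0; split; [exact hC0|]; intros X hX EX.
        destruct (Rtotal_order X C0) as [h|[h|h]]; [|exact h|].
        + pose proof (sqrt_lt_1_alt X C0 ltac:(lra)); nra.
        + pose proof (sqrt_lt_1_alt C0 X ltac:(lra)); nra.
      - exists 1; split; [lra|]; intros X hX EX; exfalso; apply hno; eauto. }
    destruct hx as [C0 [hC0 huniq]]; exists C0; split; [exact hC0|].
    intros eps q0 T F Phi0 z zm zp heps _ hdata hT hrho _.
    assert (hR : 0 < Rpower eps (2 * p)) by apply exp_pos.
    rewrite (rho_scaling p kappa gamma K A0 B B0 B1 B2 eps q0 T Phi0 z zm zp
                  heps hB hB0 hB2 ltac:(lra) hdata) in hrho.
    apply Rmult_eq_reg_r in hrho; [|lra].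
    rewrite <- (huniq (Rpower eps (2 * p) * T)).
    + field; lra.
    + apply Rmult_lt_0_compat; assumption.
    + exact hrho.
Qed.
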